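(* Let $\mu$ be a measure. Then the (real or complex) space $L_1(\mu)$ has the Bishop-Phelps-Bollobás property for numerical radius. More precisely, given $\varepsilon>0$, there exists $\eta(\varepsilon)>0$ (which does not depend on $\mu$) such that whenever $T_0\in\mathcal{L}(L_1(\mu))$ with $v(T_0)=1$ and $(f_0,g_0)\in\Pi(L_1(\mu))$ satisfy $|\langle T_0f_0,g_0\rangle|>1-\eta(\varepsilon)$, there exist $T\in\mathcal{L}(L_1(\mu))$ and $(f_1,g_1)\in\Pi(L_1(\mu))$ such that $$|\langle Tf_1,g_1\rangle|=v(T)=1,\quad \|f_0-f_1\|<\varepsilon,\quad \|g_0-g_1\|<\varepsilon\quad\text{and}\quad \|T-T_0\|<\varepsilon.$$
   Context: For a real or complex Banach space $X$ with dual $X^*$ and unit sphere $S_X$, $\mathcal{L}(X)$ is the space of bounded linear operators on $X$ with the operator norm, and $\Pi(X)=\{(x,x^* )\in S_X\times S_{X^*} : x^*(x)=1\}$. The numerical radius of $T\in\mathcal{L}(X)$ is $v(T)=\sup\{|x^*(Tx)| : (x,x^* )\in\Pi(X)\}$. For $f\in L_1(\mu)$ and $g\in L_1(\mu)^*$, $\langle f,g\rangle=g(f)$ denotes the (bilinear) duality pairing. $X$ has the Bishop-Phelps-Bollobás property for numerical radius (BPBp-nu) if for every $0<\varepsilon<1$ there exists $\eta(\varepsilon)>0$ such that whenever $T\in\mathcal{L}(X)$ and $(x,x^* )\in\Pi(X)$ satisfy $v(T)=1$ and $|x^*(Tx)|>1-\eta(\varepsilon)$, there exist $S\in\mathcal{L}(X)$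 and $(y,y^* )\in\Pi(X)$ with $v(S)=|y^*(Sy)|=1$, $\|T-S\|<\varepsilon$, $\|x-y\|<\varepsilon$ and $\|x^*-y^*\|<\varepsilon$. *)

(* Defs.v *)
From HB Require Import structures.
From mathcomp Require Import all_boot all_order all_algebra.
From mathcomp Require Import generic_quotient ring_quotient complex.
From mathcomp Require Import all_classical all_reals all_analysis.
From mathcomp Require Import measurable_realfun.

Set Implicit Arguments.
Unset Strict Implicit.
Unset Printing Implicit Defensive.

Import Order.TTheory GRing.Theory Num.Theory.
Import numFieldNormedType.Exports.

Local Open Scope classical_set_scope.
Local Open Scope ring_scope.
Local Open Scope quotient_scope.

Inductive scalar_kind := RealScalars | ComplexScalars.

Definition scalar_field (R : realType) (k : scalar_kind) : numFieldType :=
  match k with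
  | RealScalars => R
  | ComplexScalars => R[i]
  end.

Section Scalars.
Context {R : realType} {k : scalar_kind}.
Local Notation K := (scalar_field R k).

Definition reS : K -> R :=
  match k return scalar_field R k -> R with
  | RealScalars => id
  | ComplexScalars => @complex.Re R
  end.

Definition imS : K -> R :=
  match k return scalar_field R k -> R with
  | RealScalars => cst 0
  | ComplexScalars => @complex.Im R
  end.

Definition ofR : R -> K :=
  match k return R -> scalar_field R k with
  | RealScalars => id
  | ComplexScalars => fun r => (r%:C)%C
  end.

(* A norm over K takes its values in the nonnegative reals of K; rnorm is the
   same norm, read in R. *)
Definition rnorm (V : normedModType K) (x : V) : R := reS `|x|.

Definition absS (z : K) : R := reS `|z|.

End Scalars.

Section ScalarTheory.
Context {R : realType} {k : scalar_kind}.
Local Notation K := (scalar_field R k).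
Implicit Types (a b z : K) (r s : R).

Lemma reSD a b : reS (a + b) = reS a + reS b.
Proof. by move: a b; rewrite /reS; case: k => //= -[? ?] [? ?]. Qed.

Lemma imSD a b : imS (a + b) = imS a + imS b.
Proof.
move: a b; rewrite /imS; case: k => /=; first by move=> *; rewrite addr0.
by move=> [? ?] [? ?].
Qed.

Lemma reSM a b : reS (a * b) = reS a * reS b - imS a * imS b.
Proof.
move: a b; rewrite /reS /imS; case: k => /=; first by move=> *; rewrite mulr0 subr0.
by move=> [? ?] [? ?].
Qed.

Lemma imSM a b : imS (a * b) = reS a * imS b + imS a * reS b.
Proof.
move: a b; rewrite /reS /imS; case: k => /=.
  by move=> *; rewrite mulr0 mul0r addr0.
by move=> [? ?] [? ?].
Qed.

Lemma absSE z : absS z = Num.sqrt (reS z ^+ 2 + imS z ^+ 2).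
Proof.
move: z; rewrite /absS /reS /imS; case: k => /= [z|[a b] //].
by rewrite /= expr0n /= addr0 sqrtr_sqr.
Qed.

Lemma ofRK : cancel (@ofR R k) reS.
Proof. by rewrite /ofR /reS; case: k. Qed.

Lemma ofRD r s : ofR (r + s) = ofR r + ofR s :> K.
Proof. by rewrite /ofR; case: k => //=; rewrite rmorphD. Qed.

Lemma ofRM r s : ofR (r * s) = ofR r * ofR s :> K.
Proof. by rewrite /ofR; case: k => //=; rewrite rmorphM. Qed.

Lemma ler_ofR r s : (ofR r <= ofR s :> K) = (r <= s).
Proof. by rewrite /ofR; case: k => //=; rewrite lecR. Qed.

Lemma ofR_absS z : ofR (absS z) = `|z|.
Proof.
move: z; rewrite /ofR /absS /reS; case: k => //=.
Qed.

Lemma absS_ge0 z : 0 <= absS z.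
Proof. by rewrite absSE sqrtr_ge0. Qed.

Lemma absSM a b : absS (a * b) = absS a * absS b.
Proof. by rewrite -[LHS]ofRK ofR_absS normrM -!ofR_absS -ofRM ofRK. Qed.

Lemma ler_absSD a b : absS (a + b) <= absS a + absS b.
Proof. by rewrite -(ler_ofR (absS _)) ofRD !ofR_absS ler_normD. Qed.

Lemma absS_eq0 z : absS z = 0 -> z = 0.
Proof.
move=> z0; apply/eqP; rewrite -normr_eq0 -ofR_absS z0.
by rewrite /ofR; case: k => /=.
Qed.

Lemma absS0 : absS (0 : K) = 0.
Proof. by rewrite /absS normr0 /reS; case: k. Qed.

Lemma reS0 : reS (0 : K) = 0.
Proof. by rewrite /reS; case: k. Qed.

Lemma imS0 : imS (0 : K) = 0.
Proof. by rewrite /imS; case: k. Qed.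

End ScalarTheory.

(* L_1(mu): measurable functions with integrable modulus, modulo equality
   almost everywhere. *)
Section L1.
Context {R : realType} (k : scalar_kind) {d : measure_display}
  {T : measurableType d} (mu : {measure set T -> \bar R}).
Local Notation K := (scalar_field R k).

(* Componentwise measurability; imS vanishes over the reals, and over R[i] this
   is Borel measurability. *)
Definition measurable_scalar (f : T -> K) :=
  measurable_fun [set: T] (reS \o f) /\ measurable_fun [set: T] (imS \o f).

Definition L1int (f : T -> K) : \bar R := (\int[mu]_x (absS (f x))%:E)%E.

Definition L1pred : {pred T -> K^o} :=
  fun f => `[< measurable_scalar f /\ (L1int f < +oo)%E >].

Lemma measurable_absS f : measurable_scalar f ->
  measurable_fun [set: T] (EFin \o (absS \o f)).
Proof.
move=> [mr mi]; apply/measurable_EFinP.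
rewrite (_ : _ \o _ =
  Num.sqrt \o ((fun x => (reS \o f) x ^+ 2) \+ (fun x => (imS \o f) x ^+ 2))).
  apply: measurableT_comp.
    by apply: continuous_measurable_fun; refine (@sqrt_continuous R).
  by apply: measurable_funD; apply: measurable_funX.
by apply/funext => x /=; rewrite absSE.
Qed.

Lemma L1int_ge0 f : (0 <= L1int f)%E.
Proof. by apply: integral_ge0 => x _; rewrite lee_fin absS_ge0. Qed.

Lemma L1intD f g : measurable_scalar f -> measurable_scalar g ->
  (L1int (fun x => f x + g x)%R <= L1int f + L1int g)%E.
Proof.
move=> mf mg; rewrite /L1int -ge0_integralD//; first last.
- exact: measurable_absS.
- by move=> x _; rewrite lee_fin absS_ge0.
- exact: measurable_absS.
- by move=> x _; rewrite lee_fin absS_ge0.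
apply: ge0_le_integral => //.
- by move=> x _; rewrite lee_fin absS_ge0.
- apply: (@measurable_absS (fun x => f x + g x)).
  move: mf mg => [rf imf] [rg img]; split.
    rewrite (_ : _ \o _ = (reS \o f) \+ (reS \o g)); first exact: measurable_funD.
    by apply/funext => x /=; rewrite reSD.
  rewrite (_ : _ \o _ = (imS \o f) \+ (imS \o g)); first exact: measurable_funD.
  by apply/funext => x /=; rewrite imSD.
- by apply: emeasurable_funD; exact: measurable_absS.
- by move=> x _; rewrite -EFinD lee_fin ler_absSD.
Qed.

Lemma L1intZ a f : measurable_scalar f ->
  L1int (fun x => a * f x) = ((absS a)%:E * L1int f)%E.
Proof.
move=> mf; rewrite /L1int -ge0_integralZl_EFin ?absS_ge0//.
- by apply: eq_integral => x _; rewrite absSM.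
- by move=> x _; rewrite lee_fin absS_ge0.
- exact: measurable_absS.
Qed.

Lemma measurable_scalarMD a f g : measurable_scalar f -> measurable_scalar g ->
  measurable_scalar (fun x => a * f x + g x).
Proof.
move=> [rf imf] [rg img]; split.
  rewrite (_ : _ \o _ = (((fun x => reS a * (reS \o f) x) \-
     (fun x => imS a * (imS \o f) x)) \+ (reS \o g))).
    apply: measurable_funD => //; apply: measurable_funB; exact: measurable_funM.
  by apply/funext => x /=; rewrite reSD reSM.
rewrite (_ : _ \o _ = (((fun x => reS a * (imS \o f) x) \+
   (fun x => imS a * (reS \o f) x)) \+ (imS \o g))).
  apply: measurable_funD => //; apply: measurable_funD; exact: measurable_funM.
by apply/funext => x /=; rewrite imSD imSM.
Qed.

Lemma measurable_scalar0 : measurable_scalar (fun=> 0).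
Proof. by split; exact: measurable_cst. Qed.

Lemma measurable_scalarM a f : measurable_scalar f ->
  measurable_scalar (fun x => a * f x).
Proof.
move=> mf; have := measurable_scalarMD a mf measurable_scalar0.
by under eq_fun do rewrite addr0.
Qed.

Lemma L1pred_submod_closed : submod_closed L1pred.
Proof.
split.
  apply/asboolP; split; first exact: measurable_scalar0.
  rewrite /L1int (eq_integral (cst 0%E)) ?integral0 ?ltry// => x _ /=.
  by rewrite -[X in absS X]/(0 : K) absS0.
move=> a f g /asboolP[mf lf] /asboolP[mg lg]; apply/asboolP; split.
  exact: measurable_scalarMD.
apply: (le_lt_trans (L1intD (measurable_scalarM a mf) mg)).
rewrite L1intZ//; apply: lte_add_pinfty => //.
by apply: lte_mul_pinfty => //; rewrite lee_fin absS_ge0.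
Qed.

HB.instance Definition _ := GRing.isSubmodClosed.Build K (T -> K^o) L1pred
  L1pred_submod_closed.

Record L1fun := MkL1fun { L1val :> T -> K^o ; _ : L1val \in L1pred }.

HB.instance Definition _ := [isSub for L1val].
HB.instance Definition _ := [Choice of L1fun by <:].
HB.instance Definition _ := [SubChoice_isSubLmodule of L1fun by <:].

Definition L1null : {pred L1fun} := fun f => `[< {ae mu, forall x, f x = 0} >].

Lemma L1null_zmod_closed : zmod_closed L1null.
Proof.
split; first by apply/asboolP; apply: nearW => x.
move=> f g /asboolP f0 /asboolP g0; apply/asboolP.
apply: filterS2 f0 g0 => x /= fx gx.
by change (L1val f x - L1val g x = 0); rewrite fx gx subr0.
Qed.

HB.instance Definition _ := GRing.isZmodClosed.Build L1fun L1null
  L1null_zmod_closed.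

(* The normed module structure on this quotient is given at the end of the
   section; its norm is L1norm. *)
Definition L1 : Type := Quotient.quot L1null.

HB.instance Definition _ := GRing.Zmodule.on L1.
HB.instance Definition _ := EqQuotient.on L1.

Definition L1scale (a : K) (f : L1) : L1 := \pi_L1 (a *: repr f).

Definition L1norm (f : L1) : K := ofR (fine (L1int (repr f))).

Lemma L1fun_measurable (f : L1fun) : measurable_scalar f.
Proof. by case: f => f /= /asboolP[]. Qed.

Lemma L1int_fin (f : L1fun) : L1int f \is a fin_num.
Proof. by rewrite ge0_fin_numE ?L1int_ge0//; case: f => f /= /asboolP[]. Qed.

Lemma L1_eqP (f g : L1fun) :
  (\pi_L1 f = \pi_L1 g) <-> {ae mu, forall x, f x = g x}.
Proof.
split=> [/eqmodP/asboolP|fg].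
  by apply: filterS => x fgx; apply/eqP; rewrite -subr_eq0; apply/eqP.
apply/eqmodP/asboolP; apply: filterS fg => x fgx.
by change (L1val f x - L1val g x = 0); rewrite fgx subrr.
Qed.

Lemma L1int_ae (f g : L1fun) : {ae mu, forall x, f x = g x} -> L1int f = L1int g.
Proof.
move=> fg; apply: ge0_ae_eq_integral => //.
- exact/measurable_absS/L1fun_measurable.
- exact/measurable_absS/L1fun_measurable.
- by move=> x _; rewrite lee_fin absS_ge0.
- by move=> x _; rewrite lee_fin absS_ge0.
- by apply: filterS fg => x -> _.
Qed.

Lemma L1scale_pi a (f : L1fun) : L1scale a (\pi_L1 f) = \pi_L1 (a *: f).
Proof.
apply/L1_eqP; have /L1_eqP : \pi_L1 (repr (\pi_L1 f)) = \pi_L1 f by rewrite reprK.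
by apply: filterS => x fx; change (a * L1val (repr (\pi_L1 f)) x = a * L1val f x); rewrite fx.
Qed.

Lemma L1norm_pi (f : L1fun) : L1norm (\pi_L1 f) = ofR (fine (L1int f)).
Proof.
by congr (ofR (fine _)); apply: L1int_ae; apply/L1_eqP; rewrite reprK.
Qed.

Lemma L1piD (f g : L1fun) : \pi_L1 (f + g) = \pi_L1 f + \pi_L1 g.
Proof. exact: (Quotient.pi_add L1null f g). Qed.

Lemma L1scaleA a b f : L1scale a (L1scale b f) = L1scale (a * b) f.
Proof. by elim/quotW: f => f; rewrite [L1scale b _]L1scale_pi !L1scale_pi scalerA. Qed.

Lemma L1scale1 : left_id 1 L1scale.
Proof. by elim/quotW => f; rewrite L1scale_pi scale1r. Qed.

Lemma L1scaleDr : right_distributive L1scale +%R.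
Proof.
move=> a; elim/quotW => f; elim/quotW => g.
by rewrite -L1piD !L1scale_pi -L1piD scalerDr.
Qed.

Lemma L1scaleDl f : {morph L1scale^~ f : a b / a + b}.
Proof. by elim/quotW: f => f a b; rewrite !L1scale_pi -L1piD scalerDl. Qed.

HB.instance Definition _ :=
  GRing.Zmodule_isLmodule.Build K L1 L1scaleA L1scale1 L1scaleDr L1scaleDl.

Lemma ler_L1normD f g : L1norm (f + g) <= L1norm f + L1norm g.
Proof.
elim/quotW: f => f; elim/quotW: g => g.
rewrite -L1piD !L1norm_pi -ofRD ler_ofR -fineD ?L1int_fin//.
apply: fine_le; first exact: L1int_fin.
  by rewrite (fin_numD (L1int f) (L1int g)) !L1int_fin.
exact: (L1intD (L1fun_measurable f) (L1fun_measurable g)).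
Qed.

Lemma L1normZ a f : L1norm (a *: f) = `|a| * L1norm f.
Proof.
elim/quotW: f => f; rewrite [a *: _]L1scale_pi !L1norm_pi -ofR_absS -ofRM.
congr ofR; rewrite -[RHS]/(fine (absS a)%:E * fine (L1int f)) -fineM ?L1int_fin//.
by rewrite -(L1intZ a (L1fun_measurable f)).
Qed.

Lemma L1norm_eq0 f : L1norm f = 0 -> f = 0.
Proof.
elim/quotW: f => f; rewrite L1norm_pi => /(congr1 reS).
rewrite ofRK reS0 => f0.
have : L1int f = 0%E by rewrite -(fineK (L1int_fin f)) f0.
rewrite /L1int => {}f0.
have -> : 0 = \pi_L1 (0 : L1fun) by rewrite -[RHS]addr0 -[in RHS](subrr (\pi_L1 0)) addrA -L1piD addr0 subrr.
apply/L1_eqP.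
have mf := measurable_absS (L1fun_measurable f).
have /(ae_eq_integral_abs mu measurableT mf) :
    (\int[mu]_x `|(EFin \o (absS \o f)) x| = 0)%E.
  rewrite -[RHS]f0; apply: eq_integral => x _ /=.
  by rewrite ger0_norm// absS_ge0.
by apply: filterS => x /= /(_ I)[]/absS_eq0.
Qed.

HB.instance Definition _ :=
  Lmodule_isNormed.Build K L1 ler_L1normD L1normZ L1norm_eq0.

End L1.

Section NumericalRadius.
Context {R : realType} {k : scalar_kind} (X : normedModType (scalar_field R k)).
Local Notation K := (scalar_field R k).

(* Operator norm of a bounded linear map; the norm of X^* is the case Y = K^o.
   As a real supremum it is meaningful only for bounded f. *)
Definition opnorm (Y : normedModType K) (f : X -> Y) : R :=
  sup [set rnorm (f x) | x in [set x : X | rnorm x <= 1]].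

(* (x, phi) belongs to Pi(X) *)
Definition numstate (x : X) (phi : {linear X -> K^o}) : Prop :=
  [/\ rnorm x = 1, continuous phi, opnorm phi = 1 & phi x = 1].

Definition numradius (A : X -> X) : R :=
  sup [set r | exists (x : X) (phi : {linear X -> K^o}),
    numstate x phi /\ r = absS (phi (A x))].

Definition BPBp_nu : Prop :=
  forall eps : R, 0 < eps < 1 ->
  exists2 eta : R, 0 < eta &
    forall (A : {linear X -> X}) (x : X) (phi : {linear X -> K^o}),
      continuous A -> numstate x phi ->
      numradius A = 1 -> absS (phi (A x)) > 1 - eta ->
      exists (B : {linear X -> X}) (y : X) (psi : {linear X -> K^o}),
        [/\ continuous B, numstate y psi &
            numradius B = absS (psi (B y)) /\ absS (psi (B y)) = 1] /\
        [/\ opnorm (A \- B) < eps, rnorm (x - y) < eps &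
            opnorm (phi \- psi) < eps].

End NumericalRadius.

(* Main.v *)
Require Import Defs.
From HB Require Import structures.
From mathcomp Require Import all_boot all_order all_algebra.
From mathcomp Require Import generic_quotient ring_quotient complex.
From mathcomp Require Import all_classical all_reals all_analysis.
From mathcomp Require Import measurable_realfun lra ring.

Set Implicit Arguments.
Unset Strict Implicit.
Unset Printing Implicit Defensive.

Import Order.TTheory GRing.Theory Num.Theory.
Import numFieldNormedType.Exports.
Local Open Scope classical_set_scope.
Local Open Scope ring_scope.
Local Open Scope quotient_scope.

(** Write L for the space L1. The proof perturbs an operator A of norm 1 and a
   state (f0, g0) for which the real part of g0 (A f0) is almost 1; a general
   operator is reduced to this by rotating it by a scalar of modulus 1.

   First, the numerical radius of a bounded operator on L is its norm
   (rnorm_numradius), so that A is a contraction and the perturbed operator only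
   has to be a contraction as well.

   Next, let r = A f0. Since g0 almost norms r, a Hahn decomposition yields a set
   which carries almost all of r and on all of whose subsets g0 almost norms r
   (markov_hahn). There g0 is close to the conjugate sign of r, by density of
   the products of r with simple functions (close_csgn); on the support of f0 it
   is equal to the conjugate sign of f0. Replacing g0 by these signs gives a
   functional g1 close to g0 which, on a set carrying f0 and almost all of r, is
   the integral against a function G of modulus 1 (perturb_functional). No
   function representing g0 itself is involved, so the measure is arbitrary.
   The same Hahn argument provides a restriction a of f0, close to f0, such that
   G almost norms the image under A of each restriction of a.

   In terms of a kernel of A on the support of a, this means that the kernel,
   once multiplied by G, is almost positive. Replacing it there by the positive
   part of its real part, and adding an operator of rank 1 to restore the mass
   which is lost, gives a contraction close to A for which G norms the image of
   a exactly. As there is no kernel to begin with, the positive part is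
   constructed as the limit, along finite measurable partitions, of the operators
   obtained by averaging over the cells (positive_part_operator). The limit
   exists because positive parts are subadditive, so that the approximations
   increase under refinement with a bounded total mass. *)

(** * Scalars *)

Section Scalar.
Context {R : realType} {k : scalar_kind}.
Local Notation K := (scalar_field R k).
Implicit Types (a b z : K) (r s : R).

(** Zero over the reals, which have no imaginary part: this makes the
   decomposition into real and imaginary parts uniform in the scalar field. *)
Definition iS : K :=
  match k return scalar_field R k with
  | RealScalars => 0
  | ComplexScalars => 'i%C
  end.

(** The conjugate of the sign of z; it vanishes at 0, where the inverse is 0. *)
Definition csgn z : K := `|z| / z.

Lemma reim_eq a b : reS a = reS b -> imS a = imS b -> a = b.
Proof.
by move: a b; rewrite /reS /imS; case: k => //= -[? ?] [? ?] /= -> ->.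
Qed.

Lemma reS_ofR r : reS (ofR r : K) = r. Proof. exact: ofRK. Qed.

Lemma imS_ofR r : imS (ofR r : K) = 0.
Proof. by rewrite /imS /ofR; case: k. Qed.

Lemma ofR0 : ofR 0 = 0 :> K. Proof. by rewrite /ofR; case: k. Qed.

Lemma ofR1 : ofR 1 = 1 :> K. Proof. by rewrite /ofR; case: k. Qed.

Lemma ofRN r : ofR (- r) = - ofR r :> K.
Proof. by apply/eqP; rewrite -addr_eq0 -ofRD addNr ofR0. Qed.

Lemma ofR_inj : injective (@ofR R k).
Proof. exact: can_inj ofRK. Qed.

Lemma ofR_sum (I : Type) (s : seq I) (P : pred I) (F : I -> R) :
  ofR (\sum_(i <- s | P i) F i) = \sum_(i <- s | P i) ofR (F i) :> K.
Proof. by rewrite (big_morph _ ofRD ofR0). Qed.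

Lemma reSN a : reS (- a) = - reS a.
Proof. by apply/eqP; rewrite -addr_eq0 -reSD addNr reS0. Qed.

Lemma imSN a : imS (- a) = - imS a.
Proof. by apply/eqP; rewrite -addr_eq0 -imSD addNr imS0. Qed.

Lemma reSB a b : reS (a - b) = reS a - reS b.
Proof. by rewrite reSD reSN. Qed.

Lemma imSB a b : imS (a - b) = imS a - imS b.
Proof. by rewrite imSD imSN. Qed.

Lemma reS_sum (I : Type) (s : seq I) (P : pred I) (F : I -> K) :
  reS (\sum_(i <- s | P i) F i) = \sum_(i <- s | P i) reS (F i).
Proof. by rewrite (big_morph _ reSD reS0). Qed.

Lemma reSZ r a : reS (ofR r * a) = r * reS a.
Proof. by rewrite reSM reS_ofR imS_ofR mul0r subr0. Qed.

Lemma imSZ r a : imS (ofR r * a) = r * imS a.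
Proof. by rewrite imSM reS_ofR imS_ofR mul0r addr0. Qed.

Lemma reS_iS r : reS (iS * ofR r) = 0.
Proof.
by rewrite mulrC reSZ /iS /reS; case: k => /=; rewrite mulr0.
Qed.

Lemma imS_iS : imS (iS : K) = 1 \/ forall z, imS z = 0.
Proof. by rewrite /imS /iS; case: k; [right|left]. Qed.

Lemma scalarE z : z = ofR (reS z) + iS * ofR (imS z).
Proof.
apply: reim_eq; first by rewrite reSD reS_ofR reS_iS addr0.
rewrite imSD imS_ofR add0r mulrC imSZ.
by move: z; rewrite /imS /iS; case: k => //= z; rewrite ?mulr0 ?mulr1.
Qed.

Lemma reS_le z : reS z <= absS z.
Proof.
rewrite absSE (le_trans (ler_norm _))// -sqrtr_sqr ler_wsqrtr//.
by rewrite lerDl sqr_ge0.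
Qed.

Lemma absS_sqr z : absS z ^+ 2 = reS z ^+ 2 + imS z ^+ 2.
Proof. by rewrite absSE sqr_sqrtr// addr_ge0// sqr_ge0. Qed.

Lemma norm_reS z : `|reS z| <= absS z.
Proof. by rewrite absSE -sqrtr_sqr ler_wsqrtr// lerDl sqr_ge0. Qed.

Lemma norm_imS z : `|imS z| <= absS z.
Proof. by rewrite absSE -sqrtr_sqr ler_wsqrtr// lerDr sqr_ge0. Qed.

Lemma absS_ofR r : absS (ofR r : K) = `|r|.
Proof. by rewrite absSE reS_ofR imS_ofR expr0n addr0 sqrtr_sqr. Qed.

Lemma absS1 : absS (1 : K) = 1.
Proof. by rewrite -ofR1 absS_ofR normr1. Qed.

Lemma absSN z : absS (- z) = absS z.
Proof. by rewrite /absS normrN. Qed.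

Lemma absSV z : absS z^-1 = (absS z)^-1.
Proof.
have [->|z0] := eqVneq z 0; first by rewrite invr0 absS0 invr0.
have z0' : absS z != 0 by apply: contra_neq z0; exact: absS_eq0.
by apply: (mulfI z0'); rewrite -absSM !divff// absS1.
Qed.

Lemma absS_le_reim z : absS z <= `|reS z| + `|imS z|.
Proof.
rewrite -(@ler_pXn2r _ 2) ?nnegrE ?absS_ge0 ?addr_ge0//.
rewrite absS_sqr -(real_normK (num_real (reS z))) -(real_normK (num_real (imS z))).
by have := normr_ge0 (reS z); have := normr_ge0 (imS z); nra.
Qed.

Lemma absS_csgn z : absS (csgn z) = (z != 0)%:R.
Proof.
rewrite /csgn -ofR_absS absSM absSV absS_ofR ger0_norm ?absS_ge0//.
have [->|z0] := eqVneq z 0; first by rewrite absS0 mul0r.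
by rewrite divff//; apply: contra_neq z0; exact: absS_eq0.
Qed.

Lemma absS_csgn_le1 z : absS (csgn z) <= 1.
Proof. by rewrite absS_csgn; case: (_ != _). Qed.

Lemma csgnM z : csgn z * z = ofR (absS z).
Proof.
rewrite /csgn -ofR_absS; have [->|z0] := eqVneq z 0.
  by rewrite absS0 mulr0 ofR0.
by rewrite divfK.
Qed.

Lemma absS_le_reS z r : absS z <= r -> r <= reS z -> z = ofR r.
Proof.
move=> zr rz; have zz := reS_le z.
have E : reS z = r by apply/eqP; rewrite eq_le (le_trans zz).
have E' : absS z = r by apply/eqP; rewrite eq_le zr -E.
apply: reim_eq; rewrite ?reS_ofR// imS_ofR.
have /eqP := absS_sqr z; rewrite E E' -subr_eq0 opprD addrA subrr sub0r oppr_eq0.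
by rewrite sqrf_eq0 => /eqP.
Qed.

Lemma reSV z : reS z^-1 = reS z / (reS z ^+ 2 + imS z ^+ 2).
Proof.
move: z; rewrite /reS /imS; case: k => //= z.
  have [->|z0] := eqVneq z 0; first by rewrite invr0 mul0r.
  by rewrite expr0n addr0 expr2 invfM mulrA divff// mul1r.
by case: z.
Qed.

Lemma imSV z : imS z^-1 = - (imS z / (reS z ^+ 2 + imS z ^+ 2)).
Proof.
move: z; rewrite /reS /imS; case: k => //= z; first by rewrite mul0r oppr0.
by case: z => a b /=; rewrite ?mulNr.
Qed.

End Scalar.

(** * Real-valued norms and bounded operators *)

Section RNorm.
Context {R : realType} {k : scalar_kind}.
Local Notation K := (scalar_field R k).
Context {V : normedModType K}.
Implicit Types (x y : V) (a : K).

Lemma ofR_rnorm x : ofR (rnorm x) = `|x|.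
Proof.
rewrite /rnorm; have := normr_ge0 x; set n : K := `|x|; move: n.
rewrite /ofR /reS; case: k => //= -[a b]; rewrite lecE /= => /andP[/eqP -> _].
by [].
Qed.

Lemma rnorm_ge0 x : 0 <= rnorm x.
Proof. by rewrite -(ler_ofR (k := k)) ofR0 ofR_rnorm. Qed.

Lemma rnormD x y : rnorm (x + y) <= rnorm x + rnorm y.
Proof. by rewrite -(ler_ofR (k := k)) ofRD !ofR_rnorm ler_normD. Qed.

Lemma rnormZ a x : rnorm (a *: x) = absS a * rnorm x.
Proof.
by apply: (@ofR_inj _ k); rewrite ofRM !ofR_rnorm ofR_absS normrZ.
Qed.

Lemma rnorm0 : rnorm (0 : V) = 0.
Proof. by rewrite /rnorm normr0 reS0. Qed.

Lemma rnormN x : rnorm (- x) = rnorm x.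
Proof. by rewrite /rnorm normrN. Qed.

Lemma rnormB x y : rnorm (x - y) = rnorm (y - x).
Proof. by rewrite -rnormN opprB. Qed.

Lemma rnormB_le x y : rnorm x - rnorm y <= rnorm (x - y).
Proof. by rewrite lerBlDr (le_trans _ (rnormD _ _))// subrK. Qed.

Lemma rnorm_eq0 x : rnorm x = 0 -> x = 0.
Proof.
by move=> x0; apply/eqP; rewrite -normr_eq0 -ofR_rnorm x0 ofR0.
Qed.

Lemma rnorm_sum (I : Type) (s : seq I) (P : pred I) (F : I -> V) :
  rnorm (\sum_(i <- s | P i) F i) <= \sum_(i <- s | P i) rnorm (F i).
Proof.
elim/big_rec2 : _ => [|i u v _ le_vu]; first by rewrite rnorm0.
by rewrite (le_trans (rnormD _ _))// lerD2l.
Qed.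

Lemma rnorm_small x : (forall e : R, 0 < e -> rnorm x <= e) -> x = 0.
Proof.
move=> h; apply: rnorm_eq0; apply/eqP; rewrite eq_le rnorm_ge0 andbT.
by apply/ler_addgt0Pl => e /h; rewrite addr0.
Qed.

End RNorm.

Lemma rnorm_absS {R : realType} {k} (z : (scalar_field R k)^o) :
  rnorm z = absS z.
Proof. by []. Qed.

Section Operators.
Context {R : realType} {k : scalar_kind}.
Local Notation K := (scalar_field R k).
Context {X Y : normedModType K}.

Lemma lin_map_exists (f : X -> Y) :
  (forall a x y, f (a *: x + y) = a *: f x + f y) ->
  {L : {linear X -> Y} | forall x, L x = f x}.
Proof.
move=> lf; pose m := GRing.isLinear.Build K X Y *:%R f lf.
pose L : {linear X -> Y} := HB.pack f m.
by exists L.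
Qed.

Lemma bounded_continuous (f : {linear X -> Y}) (C : R) :
  (forall x, rnorm (f x) <= C * rnorm x) -> continuous f.
Proof.
move=> h; apply/linear_bounded_continuous/bounded_funP => r.
exists (ofR `|C| * r) => x xr.
rewrite -ofR_rnorm (le_trans (y := ofR `|C| * `|x|))//.
  rewrite -ofR_rnorm -ofRM ler_ofR (le_trans (h x))// ler_wpM2r ?rnorm_ge0//.
  exact: ler_norm.
by rewrite ler_wpM2l// -ofR0 ler_ofR.
Qed.

Lemma continuous_bounded (f : {linear X -> Y}) : continuous f ->
  exists2 C : R, 0 <= C & forall x, rnorm (f x) <= C * rnorm x.
Proof.
move=> /linear_bounded_continuous/bounded_funP/(_ 1)[M hM].
exists `|reS M|; first exact: normr_ge0.
move=> x; have [->|x0] := eqVneq x 0; first by rewrite linear0 !rnorm0 mulr0.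
have nx0 : rnorm x != 0 by apply: contra_neq x0; exact: rnorm_eq0.
have nx : 0 < rnorm x by rewrite lt_neqAle eq_sym nx0 rnorm_ge0.
have /hM : `|ofR (rnorm x)^-1 *: x| <= 1.
  rewrite -ofR_rnorm rnormZ absS_ofR ger0_norm ?invr_ge0 ?rnorm_ge0//.
  by rewrite mulVf// ofR1.
rewrite linearZ -ofR_rnorm => h.
have : rnorm (ofR (rnorm x)^-1 *: f x) <= reS M.
  move: h; set z := rnorm _; move: M {hM} => M; rewrite /ofR /reS.
  by case: (k) M => //= -[a b]; rewrite lecE => /andP[].
rewrite rnormZ absS_ofR ger0_norm ?invr_ge0 ?rnorm_ge0//.
rewrite ler_pdivrMl// mulrC => /le_trans; apply.
by rewrite ler_wpM2r ?rnorm_ge0// ler_norm.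
Qed.

Lemma opnorm_le (f : X -> Y) (C : R) : 0 <= C ->
  (forall x, rnorm (f x) <= C * rnorm x) -> opnorm f <= C.
Proof.
move=> C0 h; apply: ge_sup.
  by exists (rnorm (f 0)); exists 0 => //=; rewrite rnorm0.
move=> _ /= [x x1 <-]; rewrite (le_trans (h x))//.
by rewrite -[leRHS]mulr1 ler_wpM2l.
Qed.

Lemma rnorm_opnorm (f : {linear X -> Y}) x : continuous f ->
  rnorm (f x) <= opnorm f * rnorm x.
Proof.
move=> /continuous_bounded[C C0 h].
have [->|x0] := eqVneq x 0; first by rewrite linear0 !rnorm0 mulr0.
have nx0 : rnorm x != 0 by apply: contra_neq x0; exact: rnorm_eq0.
have nx : 0 < rnorm x by rewrite lt_neqAle eq_sym nx0 rnorm_ge0.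
rewrite -ler_pdivrMr// mulrC; apply: ub_le_sup.
  exists C => _ /= [y y1 <-]; rewrite (le_trans (h y))//.
  by rewrite -[leRHS]mulr1 ler_wpM2l.
exists (ofR (rnorm x)^-1 *: x) => /=.
  by rewrite rnormZ absS_ofR ger0_norm ?invr_ge0 ?rnorm_ge0// mulVf.
by rewrite linearZ rnormZ absS_ofR ger0_norm ?invr_ge0 ?rnorm_ge0//.
Qed.

End Operators.

(** * Elements of L1 as functions *)

Section MeasurableScalar.
Context {R : realType} {k : scalar_kind} {d : measure_display}
  {T : measurableType d}.
Local Notation K := (scalar_field R k).
Implicit Types f g : T -> K.

Lemma measurable_scalar_ofR (h : T -> R) : measurable_fun [set: T] h ->
  measurable_scalar (fun x => ofR (h x) : K).
Proof.
move=> mh; split.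
  by rewrite (_ : _ \o _ = h)//; apply/funext => x /=; rewrite reS_ofR.
rewrite (_ : _ \o _ = cst 0); first exact: measurable_cst.
by apply/funext => x /=; rewrite imS_ofR.
Qed.

Lemma measurable_scalar_mul f g : measurable_scalar f -> measurable_scalar g ->
  measurable_scalar (fun x => f x * g x).
Proof.
move=> [rf jf] [rg jg]; split.
  rewrite (_ : _ \o _ = ((reS \o f) \* (reS \o g)) \- ((imS \o f) \* (imS \o g))).
    by apply: measurable_funB; exact: measurable_funM.
  by apply/funext => x /=; rewrite reSM.
rewrite (_ : _ \o _ = ((reS \o f) \* (imS \o g)) \+ ((imS \o f) \* (reS \o g))).
  by apply: measurable_funD; exact: measurable_funM.
by apply/funext => x /=; rewrite imSM.
Qed.

Lemma measurable_scalar_inv f : measurable_scalar f ->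
  measurable_scalar (fun x => (f x)^-1).
Proof.
move=> [rf jf].
have mi : measurable_fun [set: T] (fun x => ((reS \o f) x ^+ 2 + (imS \o f) x ^+ 2)^-1).
  rewrite (_ : (fun _ => _) = (@powR R)^~ (-1) \o
      ((fun x => (reS \o f) x ^+ 2) \+ (fun x => (imS \o f) x ^+ 2))).
    apply: measurableT_comp; first exact: measurable_powR.
    by apply: measurable_funD; exact: measurable_funX.
  by apply/funext => x /=; rewrite powR_inv1// addr_ge0 ?sqr_ge0.
split.
  rewrite (_ : _ \o _ = (reS \o f) \* (fun x => ((reS \o f) x ^+ 2 + (imS \o f) x ^+ 2)^-1)).
    exact: measurable_funM.
  by apply/funext => x /=; rewrite reSV.
rewrite (_ : _ \o _ = \- ((imS \o f) \* (fun x => ((reS \o f) x ^+ 2 + (imS \o f) x ^+ 2)^-1))).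
  by apply: measurable_funN; exact: measurable_funM.
by apply/funext => x /=; rewrite imSV.
Qed.

Lemma measurable_absSR f : measurable_scalar f ->
  measurable_fun [set: T] (absS \o f).
Proof. by move=> /measurable_absS /measurable_EFinP. Qed.

Lemma measurable_scalar_csgn f : measurable_scalar f ->
  measurable_scalar (fun x => csgn (f x)).
Proof.
move=> mf; apply: measurable_scalar_mul; last exact: measurable_scalar_inv.
rewrite (_ : (fun x => `|f x|) = fun x => ofR (absS (f x))).
  by apply: measurable_scalar_ofR; exact: measurable_absSR.
by apply/funext => x; rewrite ofR_absS.
Qed.

End MeasurableScalar.

(** Measurability and the bound are bundled so that multiplication is a total
   linear operator, defined without side conditions. *)
Record mult {R : realType} (k : scalar_kind) {d : measure_display}
    (T : measurableType d) := Mult {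
  mval :> T -> scalar_field R k ;
  mvalM : measurable_scalar mval ;
  mval_le1 : forall x, absS (mval x) <= 1 }.

Section Toolkit.
Context {R : realType} {k : scalar_kind} {d : measure_display}
  {T : measurableType d} {mu : {measure set T -> \bar R}}.
Local Notation K := (scalar_field R k).
Local Notation L := (L1 k mu).
Implicit Types (f g h : L) (m : @mult R k d T).

(** A representative of the class f: identities in L1 are checked almost
   everywhere on representatives. *)
Definition fn f : T -> K := L1val (repr f).

Definition good (p : T -> K) := measurable_scalar p /\ (L1int mu p < +oo)%E.

(** Locked, so that the classes of two functions are never compared by unfolding
   the quotient. *)
Definition L1of_def (p : T -> K) : L := \pi_L (insubd (0 : L1fun k mu) p).
Definition L1of := locked L1of_def.

Lemma fnP f : good (fn f).
Proof. by rewrite /good /fn; case: (repr f) => p /= /asboolP. Qed.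

Lemma fnM f : measurable_scalar (fn f). Proof. by case: (fnP f). Qed.

Lemma fn_pi (p : L1fun k mu) : {ae mu, forall x, fn (\pi_L p) x = p x}.
Proof. by apply/L1_eqP; rewrite reprK. Qed.

Lemma fn_of (p : T -> K) : good p -> {ae mu, forall x, fn (L1of p) x = p x}.
Proof.
move=> gp; have pp : p \in L1pred mu by apply/asboolP.
rewrite /L1of -lock.
by have := fn_pi (insubd (0 : L1fun k mu) p); rewrite insubdK.
Qed.

Lemma L1_ext f g : {ae mu, forall x, fn f x = fn g x} -> f = g.
Proof. by move=> /L1_eqP; rewrite !reprK. Qed.

Lemma fnD f g : {ae mu, forall x, fn (f + g) x = fn f x + fn g x}.
Proof.
by have := fn_pi (repr f + repr g); rewrite L1piD !reprK.
Qed.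

Lemma fnZ (a : K) f : {ae mu, forall x, fn (a *: f) x = a * fn f x}.
Proof. exact: (fn_pi (a *: repr f)). Qed.

Lemma fn0 : {ae mu, forall x, fn (0 : L) x = 0}.
Proof.
apply: filterS (fnZ 0 0) => x; rewrite scale0r => ->; exact: mul0r.
Qed.

Lemma fn_sum (I : Type) (s : seq I) (P : pred I) (F : I -> L) :
  {ae mu, forall x, fn (\sum_(i <- s | P i) F i) x = \sum_(i <- s | P i) fn (F i) x}.
Proof.
elim: s => [|i s ih].
  by apply: filterS fn0 => x; rewrite !big_nil.
case: (boolP (P i)) => Pi.
  apply: filterS2 ih (fnD (F i) (\sum_(i <- s | P i) F i)) => x e.
  by rewrite !big_cons Pi e.
by apply: filterS ih => x; rewrite !big_cons (negbTE Pi).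
Qed.

Lemma rnorm_int f : (rnorm f)%:E = L1int mu (fn f).
Proof.
by rewrite /rnorm /= /Num.norm/= /L1norm reS_ofR fineK// L1int_fin.
Qed.

Definition intK f : K^o :=
  ofR (\int[mu]_x reS (fn f x))%R + iS * ofR (\int[mu]_x imS (fn f x))%R.

Lemma integrable_re f : mu.-integrable [set: T] (EFin \o (reS \o fn f)).
Proof.
apply/integrableP; split; first by apply/measurable_EFinP; case: (fnM f).
apply: le_lt_trans (fnP f).2; apply: ge0_le_integral => //.
- by apply: measurableT_comp => //; apply/measurable_EFinP; case: (fnM f).
- exact: measurable_absS (fnM f).
- by move=> x _ /=; rewrite lee_fin norm_reS.
Qed.

Lemma integrable_im f : mu.-integrable [set: T] (EFin \o (imS \o fn f)).
Proof.
apply/integrableP; split; first by apply/measurable_EFinP; case: (fnM f).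
apply: le_lt_trans (fnP f).2; apply: ge0_le_integral => //.
- by apply: measurableT_comp => //; apply/measurable_EFinP; case: (fnM f).
- exact: measurable_absS (fnM f).
- by move=> x _ /=; rewrite lee_fin norm_imS.
Qed.

Lemma re_intK f : reS (intK f) = (\int[mu]_x reS (fn f x))%R.
Proof. by rewrite /intK reSD reS_ofR reS_iS addr0. Qed.

Lemma ae_Rintegral (p q : T -> R) : measurable_fun [set: T] p ->
    measurable_fun [set: T] q -> {ae mu, forall x, p x = q x} ->
  (\int[mu]_x p x = \int[mu]_x q x)%R.
Proof.
move=> mp mq pq; rewrite /Rintegral; congr fine.
apply: ae_eq_integral => //; try exact/measurable_EFinP.
by apply: filterS pq => x -> _.
Qed.

Lemma intK_lin (a : K) f g : intK (a *: f + g) = a *: intK f + intK g.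
Proof.
have [mfr mfi] := fnM f; have [mgr mgi] := fnM g.
have [mr mi] := fnM (a *: f + g).
have ifr := integrable_re f; have ifi := integrable_im f.
have igr := integrable_re g; have igi := integrable_im g.
have zi (p : T -> R) (b : R) : mu.-integrable [set: T] (EFin \o p) ->
    mu.-integrable [set: T] (EFin \o (fun x => b * p x)).
  by move=> ip; have := integrableZl measurableT b ip.
have E : {ae mu, forall x, fn (a *: f + g) x = a * fn f x + fn g x}.
  by apply: filterS2 (fnD (a *: f) g) (fnZ a f) => x -> ->.
have imI h : imS (intK h) = (\int[mu]_x imS (fn h x))%R.
  rewrite /intK imSD imS_ofR add0r mulrC imSZ.
  have [->|h0] := @imS_iS R k; first by rewrite mulr1.
  under eq_Rintegral do rewrite h0.
  by rewrite h0 mulr0 Rintegral_cst// mul0r.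
have -> : a *: intK f + intK g = a * intK f + intK g :> K by [].
apply: reim_eq.
  rewrite re_intK [RHS]reSD [reS (_ * _)]reSM !re_intK imI.
  rewrite (@ae_Rintegral _ (fun x => (reS a * reS (fn f x) + (- imS a) * imS (fn f x)) +
     reS (fn g x))).
  - rewrite !RintegralD//; [|exact: zi|exact: zi|].
      by rewrite !RintegralZl// mulNr.
    have := integrableD measurableT (zi _ (reS a) ifr) (zi _ (- imS a) ifi).
    exact.
  - exact: mr.
  - apply: measurable_funD => //; apply: measurable_funD; exact: measurable_funM.
  - by apply: filterS E => x ->; rewrite reSD reSM mulNr.
rewrite imI [RHS]imSD [imS (_ * _)]imSM !imI !re_intK.
rewrite (@ae_Rintegral _ (fun x => (reS a * imS (fn f x) + imS a * reS (fn f x)) +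
   imS (fn g x))).
- rewrite !RintegralD//; [|exact: zi|exact: zi|].
    by rewrite !RintegralZl.
  have := integrableD measurableT (zi _ (reS a) ifi) (zi _ (imS a) ifr).
  exact.
- exact: mi.
- apply: measurable_funD => //; apply: measurable_funD; exact: measurable_funM.
- by apply: filterS E => x ->; rewrite imSD imSM.
Qed.

HB.instance Definition _ := GRing.isLinear.Build K L K^o *:%R intK intK_lin.

Lemma le_re_intK f g : {ae mu, forall x, reS (fn f x) <= reS (fn g x)} ->
  reS (intK f) <= reS (intK g).
Proof.
move=> fg; have [mr mi] := fnM (g - f).
rewrite -subr_ge0 -reSB -linearB re_intK (@ae_Rintegral _ (fun x => `|reS (fn (g - f) x)|)).
- by apply: Rintegral_ge0 => x _.
- exact: mr.
- exact: measurableT_comp.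
apply: filterS3 fg (fnD g (- f)) (fnZ (-1) f) => x le_fg -> E.
by rewrite -scaleN1r E mulN1r reSB ger0_norm// subr_ge0.
Qed.

Lemma intK_abs f h : {ae mu, forall x, fn h x = ofR (absS (fn f x))} ->
  intK h = ofR (rnorm f).
Proof.
move=> E; have mf := measurable_absSR (fnM f); have [mr mi] := fnM h.
rewrite /intK.
have -> : (\int[mu]_x reS (fn h x) = \int[mu]_x absS (fn f x))%R.
  by apply: ae_Rintegral => //; apply: filterS E => x ->; rewrite reS_ofR.
have -> : (\int[mu]_x imS (fn h x) = \int[mu]_x cst 0 x)%R.
  by apply: ae_Rintegral => //; apply: filterS E => x ->; rewrite imS_ofR.
rewrite Rintegral_cst// mul0r ofR0 mulr0 addr0; congr ofR.
by rewrite /Rintegral -[RHS]/(fine (rnorm f)%:E) rnorm_int.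
Qed.

Lemma good_mul m f : good (fun x => m x * fn f x).
Proof.
split; first by apply: measurable_scalar_mul; [exact: mvalM|exact: fnM].
apply: le_lt_trans (fnP f).2; apply: ge0_le_integral => //.
- by move=> x _; rewrite lee_fin absS_ge0.
- apply: measurable_absS; apply: measurable_scalar_mul; [exact: mvalM|exact: fnM].
- exact: measurable_absS (fnM f).
- move=> x _; rewrite lee_fin absSM -[leRHS]mul1r.
  by rewrite ler_wpM2r ?absS_ge0 ?mval_le1.
Qed.

Definition Mul m f : L := L1of (fun x => m x * fn f x).

Lemma fnMul m f : {ae mu, forall x, fn (Mul m f) x = m x * fn f x}.
Proof. exact/fn_of/good_mul. Qed.

Lemma Mul_lin m (a : K) f g : Mul m (a *: f + g) = a *: Mul m f + Mul m g.
Proof.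
apply: L1_ext; near=> x.
have -> : fn (Mul m (a *: f + g)) x = m x * fn (a *: f + g) x.
  by near: x; exact: fnMul.
have -> : fn (a *: f + g) x = fn (a *: f) x + fn g x by near: x; exact: fnD.
have -> : fn (a *: f) x = a * fn f x by near: x; exact: fnZ.
have -> : fn (a *: Mul m f + Mul m g) x = fn (a *: Mul m f) x + fn (Mul m g) x.
  by near: x; exact: fnD.
have -> : fn (a *: Mul m f) x = a * fn (Mul m f) x by near: x; exact: fnZ.
have -> : fn (Mul m f) x = m x * fn f x by near: x; exact: fnMul.
have -> : fn (Mul m g) x = m x * fn g x by near: x; exact: fnMul.
by rewrite mulrDr mulrCA.
Unshelve. all: by end_near. Qed.

HB.instance Definition _ m := GRing.isLinear.Build K L L *:%R (Mul m) (Mul_lin m).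

End Toolkit.
Arguments good {R k d T} mu p.
Arguments L1of {R k d T} mu p.

(** * Multipliers and restrictions *)

Section Multipliers.
Context {R : realType} {k : scalar_kind} {d : measure_display}
  {T : measurableType d}.
Local Notation K := (scalar_field R k).
Local Notation mul := (@mult R k d T).

Lemma absS_bool (b : bool) : absS (b%:R : K) = b%:R.
Proof. by case: b; rewrite ?absS1 ?absS0. Qed.

Lemma ofR_bool (b : bool) : ofR b%:R = b%:R :> K.
Proof. by case: b; rewrite ?ofR1 ?ofR0. Qed.

Lemma measurable_mem (A : set T) : measurable A ->
  measurable_fun [set: T] (fun x => x \in A).
Proof.
move=> mA; apply: (measurable_fun_bool true); rewrite setTI.
rewrite (_ : _ @^-1` _ = A)//; apply/seteqP; split => x /=.
  by move=> /eqP; rewrite eqb_id => /set_mem.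
by move=> Ax; apply/mem_set.
Qed.

Record mset := Mset {
  bset :> T -> bool ;
  bsetM : measurable_fun [set: T] bset }.

Lemma mset_set (A : set T) : measurable A -> {B : mset | forall x, B x = (x \in A)}.
Proof.
by move=> /measurable_mem mA; exists (Mset mA).
Qed.

Definition msI (A B : mset) : mset := Mset (measurable_and (bsetM A) (bsetM B)).

Definition msC (A : mset) : mset := Mset (measurable_neg (bsetM A)).

Lemma mset_measurable (B : mset) : measurable [set x | B x].
Proof.
by rewrite -[X in measurable X]setTI; exact: (bsetM B measurableT (Y := [set true])).
Qed.

Lemma measurable_scalar_ind (B : mset) : measurable_scalar (fun x => (B x)%:R : K).
Proof.
rewrite (_ : (fun _ => _) = fun x => ofR (\1_[set x | B x] x : R)).
  by apply: measurable_scalar_ofR; apply: measurable_indic; exact: mset_measurable.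
by apply/funext => x; rewrite indicE mem_setE -ofR_bool.
Qed.

Definition ind (B : mset) : mul.
Proof.
refine (@Mult R k d T (fun x => (B x)%:R) (measurable_scalar_ind B) _).
by move=> x; rewrite absS_bool lern1 leq_b1.
Defined.

Definition mmul (m n : mul) : mul.
Proof.
refine (@Mult R k d T (fun x => m x * n x)
  (measurable_scalar_mul (mvalM m) (mvalM n)) _).
by move=> x; rewrite absSM mulr_ile1 ?absS_ge0 ?mval_le1.
Defined.

Definition mconst (a : K) (a1 : absS a <= 1) : mul.
Proof.
refine (@Mult R k d T (fun=> a) _ (fun=> a1)).
by split; exact: measurable_cst.
Defined.

Definition mif (B : mset) (m n : mul) : mul.
Proof.
refine (@Mult R k d T (fun x => if B x then m x else n x) _ _); last first.
  by move=> x; case: (B x); exact: mval_le1.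
rewrite (_ : (fun _ => _) = fun x => 1 * (ind B x * m x) + (ind (msC B) x * n x)).
  apply: measurable_scalarMD; apply: measurable_scalar_mul; exact: mvalM.
by apply/funext => x /=; case: (B x); rewrite ?mul1r ?mul0r ?addr0 ?add0r.
Defined.

End Multipliers.
Arguments mset {d} T.

Section Toolkit.
Context {R : realType} {k : scalar_kind} {d : measure_display}
  {T : measurableType d} {mu : {measure set T -> \bar R}}.
Local Notation K := (scalar_field R k).
Local Notation L := (L1 k mu).
Local Notation mul := (@mult R k d T).
Implicit Types (f g h : L) (m n : mul) (A B : mset T).

Definition mcsgn f : mul := Mult (measurable_scalar_csgn (fnM f))
  (fun x => absS_csgn_le1 (fn f x)).

Lemma supp_subproof f : measurable_fun [set: T] (fun x => fn f x != 0).
Proof.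
have -> : (fun x => fn f x != 0) = (fun x => x \in (absS \o fn f) @^-1` (~` [set 0])).
  apply/funext => x; apply/idP/idP => [fx0|].
    by apply/mem_set => /= /absS_eq0 /eqP; rewrite (negbTE fx0).
  by move/set_mem => /= fx0; apply/eqP => fx; apply: fx0; rewrite fx absS0.
apply: measurable_mem; rewrite -[X in measurable X]setTI.
by apply: (measurable_absSR (fnM f)) => //; exact: measurableC.
Qed.

(** The nonvanishing set of the representative, hence determined by f up to a null
   set only. *)
Definition supp f : mset T := Mset (supp_subproof f).

Definition rs B f : L := Mul (ind B) f.

HB.instance Definition _ B := GRing.Linear.copy (rs B) (Mul (mu := mu) (@ind R k d T B)).

Lemma fn_rs B f : {ae mu, forall x, fn (rs B f) x = (B x)%:R * fn f x}.
Proof. exact: fnMul. Qed.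

Lemma Mul_comp m n f : Mul m (Mul n f) = Mul (mmul m n) f.
Proof.
apply: L1_ext; apply: filterS3 (fnMul m (Mul n f)) (fnMul n f) (fnMul (mmul m n) f).
by move=> x -> -> ->; rewrite mulrA.
Qed.

Lemma eq_Mul m n f : {ae mu, forall x, m x * fn f x = n x * fn f x} -> Mul m f = Mul n f.
Proof.
move=> mn; apply: L1_ext; apply: filterS3 mn (fnMul m f) (fnMul n f).
by move=> x e -> ->.
Qed.

Lemma eq_Mul1 m n f : m =1 n -> Mul m f = Mul n f.
Proof. by move=> mn; apply: eq_Mul; apply: nearW => x; rewrite mn. Qed.

Lemma Mul_id m f : {ae mu, forall x, m x * fn f x = fn f x} -> Mul m f = f.
Proof.
by move=> mf; apply: L1_ext; apply: filterS2 mf (fnMul m f) => x + ->.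
Qed.

Lemma MulC m n f : Mul m (Mul n f) = Mul n (Mul m f).
Proof. by rewrite !Mul_comp; apply: eq_Mul1 => x /=; rewrite mulrC. Qed.

Lemma Mul_sum (J : finType) (P : pred J) (m : J -> mul) n f :
    (forall x, n x = \sum_(j | P j) m j x) ->
  Mul n f = \sum_(j | P j) Mul (m j) f.
Proof.
move=> E; apply: L1_ext.
have F : {ae mu, forall x, forall j, fn (Mul (m j) f) x = m j x * fn f x}.
  by apply: filter_forall => j; exact: (fnMul (m j) f).
apply: filterS3 (fnMul n f) F (fn_sum (index_enum J) P (fun j => Mul (m j) f)) => x -> Fx ->.
by rewrite E mulr_suml; apply: eq_bigr.
Qed.

Definition labs f : L := Mul (mcsgn f) f.

Lemma fn_labs f : {ae mu, forall x, fn (labs f) x = ofR (absS (fn f x))}.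
Proof. by apply: filterS (fnMul (mcsgn f) f) => x ->; rewrite csgnM. Qed.

Lemma intK_labs f : intK (labs f) = ofR (rnorm f).
Proof. exact/intK_abs/fn_labs. Qed.

Lemma le_rnorm f g : {ae mu, forall x, absS (fn f x) <= absS (fn g x)} ->
  rnorm f <= rnorm g.
Proof.
move=> fg; rewrite -[leLHS](@reS_ofR _ k) -[leRHS](@reS_ofR _ k) -!intK_labs.
apply: le_re_intK; apply: filterS3 fg (fn_labs f) (fn_labs g) => x e -> ->.
by rewrite !reS_ofR.
Qed.

Lemma rnorm_Mul m f : rnorm (Mul m f) <= rnorm f.
Proof.
apply: le_rnorm; apply: filterS (fnMul m f) => x ->.
by rewrite absSM ler_piMl ?absS_ge0 ?mval_le1.
Qed.

Lemma rnorm_rs B f : rnorm (rs B f) <= rnorm f.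
Proof. exact: rnorm_Mul. Qed.

Lemma rnorm_Mul_sum (J : finType) (P : pred J) (m : J -> mul) n f :
    (forall x, absS (n x) = \sum_(j | P j) absS (m j x)) ->
  rnorm (Mul n f) = \sum_(j | P j) rnorm (Mul (m j) f).
Proof.
move=> E; apply: (@ofR_inj _ k); rewrite -intK_labs ofR_sum.
under eq_bigr do rewrite -intK_labs.
rewrite -linear_sum; congr (intK _); apply: L1_ext.
have F : {ae mu, forall x, forall j, fn (labs (Mul (m j) f)) x = ofR (absS (m j x * fn f x))}.
  apply: filter_forall => j.
  by apply: filterS2 (fn_labs (Mul (m j) f)) (fnMul (m j) f) => x -> ->.
apply: filterS2 (filterI (fn_labs (Mul n f)) (fnMul n f)) (filterI F (fn_sum (index_enum J) P (fun j => labs (Mul (m j) f)))).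
move=> x [-> ->] [Fx ->]; rewrite absSM E mulr_suml ofR_sum; apply: eq_bigr => j _.
by rewrite Fx absSM.
Qed.

(** Rotating f so that its integral becomes nonnegative reduces the claim to the
   monotonicity of the integral on real parts. *)
Lemma absS_intK f : absS (intK f) <= rnorm f.
Proof.
rewrite -(@reS_ofR R k (absS _)) -csgnM -[leRHS](@reS_ofR _ k) -intK_labs.
rewrite -[csgn _ * _]/(csgn (intK f) *: intK f) -linearZ.
apply: le_re_intK; apply: filterS2 (fnZ (csgn (intK f)) f) (fn_labs f) => x -> ->.
rewrite reS_ofR (le_trans (reS_le _))// absSM.
by rewrite ler_piMl ?absS_ge0 ?absS_csgn_le1.
Qed.

Lemma absS_intK_Mul m f : absS (intK (Mul m f)) <= rnorm f.
Proof. exact: le_trans (absS_intK _) (rnorm_Mul _ _). Qed.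

Lemma intK_csgn_rs f B : intK (Mul (mcsgn f) (rs B f)) = ofR (rnorm (rs B f)).
Proof.
apply: intK_abs; apply: filterS2 (fnMul (mcsgn f) (rs B f)) (fn_rs B f) => x -> ->.
by rewrite mulrCA csgnM absSM absS_bool ofRM ofR_bool.
Qed.

Lemma intK_csgn f : intK (Mul (mcsgn f) f) = ofR (rnorm f).
Proof. exact: intK_labs. Qed.

Lemma rs_rs A B f : rs A (rs B f) = rs (msI A B) f.
Proof.
by rewrite /rs Mul_comp; apply: eq_Mul1 => x /=; rewrite -natrM mulnb.
Qed.

Lemma eq_rs A B f : A =1 B -> rs A f = rs B f.
Proof. by move=> AB; apply: eq_Mul1 => x /=; rewrite AB. Qed.

Lemma rsC A B f : rs A (rs B f) = rs B (rs A f).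
Proof. exact: MulC. Qed.

Lemma rs_id A f : rs A (rs A f) = rs A f.
Proof. by rewrite rs_rs; apply: eq_rs => x /=; rewrite andbb. Qed.

Lemma rs_splits B f : f = rs B f + rs (msC B) f.
Proof.
apply: L1_ext; apply: filterS3 (fn_rs B f) (fn_rs (msC B) f) (fnD (rs B f) (rs (msC B) f)).
by move=> x e1 e2 ->; rewrite e1 e2 /=; case: (B x); rewrite ?mul1r ?mul0r ?addr0 ?add0r.
Qed.

Lemma rnorm_splits B f : rnorm f = rnorm (rs B f) + rnorm (rs (msC B) f).
Proof.
have f1 : absS (1 : K) <= 1 by rewrite absS1.
rewrite -{1}(@Mul_id (mconst f1) f); last by apply: nearW => x /=; rewrite mul1r.
rewrite (@rnorm_Mul_sum _ predT (fun b : bool => if b then ind B else ind (msC B))).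
  by rewrite big_bool.
by move=> x; rewrite big_bool /= absS1 !absS_bool; case: (B x); rewrite ?addr0 ?add0r.
Qed.

Lemma rs_supp f : rs (supp f) f = f.
Proof.
apply: Mul_id; apply: nearW => x /=.
by have [->|] := eqVneq (fn f x) 0; rewrite ?mulr0 ?mul1r.
Qed.

Lemma Mul_csgn_supp f h : Mul (mcsgn f) (rs (supp f) h) = Mul (mcsgn f) h.
Proof.
rewrite /rs Mul_comp; apply: eq_Mul1 => x /=.
by have [fx|] := eqVneq (fn f x) 0; rewrite /csgn ?fx ?mulr1 ?mulr0// normr0 mul0r.
Qed.

(** * Finite measurable partitions *)

(** The cells are the fibres of a labelling, so that they are disjoint and cover
   the space by construction. *)
Record part := Part {
  idx : finType ;
  lab : T -> idx ;
  labM : forall j, measurable_fun [set: T] (fun x => lab x == j) }.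

Definition trivial_part : part.
Proof.
by refine (@Part unit (fun=> tt) _) => j; exact: measurable_cst.
Defined.

Definition cell (p : part) (j : idx p) : mset T := Mset (labM (p := p) j).

(** The map between labels lets sums over the finer partition be regrouped along
   its fibres. *)
Definition refines (p q : part) (c : idx p -> idx q) :=
  forall x, lab q x = c (lab p x).

Definition finer (p q : part) := exists c, @refines p q c.

Lemma finer_refl p : finer p p. Proof. by exists id. Qed.

Lemma finer_trans q p r : finer p q -> finer q r -> finer p r.
Proof. by move=> [c hc] [e he]; exists (e \o c) => x /=; rewrite he hc. Qed.

Definition common (p q : part) : part.
Proof.
refine (@Part (idx p * idx q)%type (fun x => (lab p x, lab q x)) _).
move=> [i j]; rewrite (_ : (fun _ => _) = fun x => (lab p x == i) && (lab q x == j)).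
  by apply: measurable_and; exact: labM.
by apply/funext => x; rewrite xpair_eqE.
Defined.

Lemma common_l p q : finer (common p q) p. Proof. by exists fst. Qed.
Lemma common_r p q : finer (common p q) q. Proof. by exists snd. Qed.

Lemma sum_cell (V : nmodType) p x (P : pred (idx p)) (F : idx p -> V) :
    (forall j, j != lab p x -> F j = 0) ->
  \sum_(j | P j) F j = if P (lab p x) then F (lab p x) else 0.
Proof.
move=> F0; rewrite big_mkcond (bigD1 (lab p x))//= big1 ?addr0// => j /F0 ->.
by case: ifP.
Qed.

Lemma rs_cell_sum p q (c : idx p -> idx q) j f : refines c ->
  rs (cell j) f = \sum_(i | c i == j) rs (cell i) f.
Proof.
move=> pq; apply: Mul_sum => x; rewrite (sum_cell (x := x)) /= ?pq; last first.
  by move=> i; rewrite eq_sym => /negbTE ->.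
by rewrite eqxx; case: (_ == _).
Qed.

Lemma rs_cells p f : f = \sum_j rs (cell (p := p) j) f.
Proof.
have f1 : absS (1 : K) <= 1 by rewrite absS1.
rewrite -{1}(@Mul_id (mconst f1) f); last by apply: nearW => x /=; rewrite mul1r.
apply: Mul_sum => x; rewrite (sum_cell (x := x)) /= ?eqxx// => i.
by rewrite eq_sym => /negbTE ->.
Qed.

Lemma rnorm_cells p f : rnorm f = \sum_j rnorm (rs (cell (p := p) j) f).
Proof.
have f1 : absS (1 : K) <= 1 by rewrite absS1.
rewrite -{1}(@Mul_id (mconst f1) f); last by apply: nearW => x /=; rewrite mul1r.
apply: rnorm_Mul_sum => x; rewrite (sum_cell (x := x)) /= ?eqxx ?absS1// => i.
by rewrite eq_sym => /negbTE ->; rewrite absS0.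
Qed.

Lemma rs_cell_cell p (i j : idx p) f :
  rs (cell i) (rs (cell j) f) = if i == j then rs (cell j) f else 0.
Proof.
have [->|ij] := eqVneq i j; first exact: rs_id.
have f0 : absS (0 : K) <= 1 by rewrite (@absS0 R k).
have z : Mul (mconst f0) f = 0.
  by apply: L1_ext; apply: filterS2 (fnMul (mconst f0) f) (@fn0 R k d T mu) => x -> ->; rewrite mul0r.
rewrite rs_rs -z; apply: eq_Mul1 => x /=; have [->|//] := eqVneq (lab p x) i.
by rewrite (negbTE ij).
Qed.

Definition step p (v : idx p -> K) f : L := \sum_j v j *: rs (cell j) f.

Lemma rs_step p (v : idx p -> K) f j : rs (cell j) (step v f) = v j *: rs (cell j) f.
Proof.
rewrite /step linear_sum (bigD1 j)//= linearZ /= rs_id big1 ?addr0// => i ij.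
by rewrite linearZ /= rs_cell_cell eq_sym (negbTE ij) scaler0.
Qed.

Lemma rnorm_step p (v : idx p -> K) f :
  rnorm (step v f) = \sum_j absS (v j) * rnorm (rs (cell j) f).
Proof.
rewrite (rnorm_cells p); apply: eq_bigr => j _.
by rewrite rs_step rnormZ.
Qed.

Lemma step_refine p q (c : idx p -> idx q) (v : idx q -> K) f : refines c ->
  step v f = step (v \o c) f.
Proof.
move=> pq; rewrite [RHS](partition_big c predT)//=; apply: eq_bigr => j _.
rewrite (rs_cell_sum j f pq) scaler_sumr; apply: eq_bigr => i /eqP <- //.
Qed.

Lemma fn_step p (v : idx p -> K) f :
  {ae mu, forall x, fn (step v f) x = v (lab p x) * fn f x}.
Proof.
have F : {ae mu, forall x, forall j : idx p, fn (v j *: rs (cell j) f) x =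
    v j * ((cell j x)%:R * fn f x)}.
  apply: filter_forall => j.
  by apply: filterS2 (fnZ (v j) (rs (cell j) f)) (fn_rs (cell j) f) => x -> ->.
apply: filterS2 F (fn_sum (index_enum _) predT (fun j => v j *: rs (cell j) f)).
move=> x Fx ->; rewrite (sum_cell (x := x)); last first.
  by move=> j; rewrite Fx eq_sym /= => /negbTE ->; rewrite mul0r mulr0.
by rewrite Fx /= eqxx mul1r.
Qed.

End Toolkit.
Arguments part {d} T.

Import HBNNSimple.

(** * Dominated convergence *)

Section Analysis.
Context {R : realType} {k : scalar_kind} {d : measure_display}
  {T : measurableType d} {mu : {measure set T -> \bar R}}.
Local Notation K := (scalar_field R k).
Local Notation L := (L1 k mu).
Implicit Types (f g h : L) (A B : mset T).

Lemma L1_dct (h : nat -> L) g :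
    {ae mu, forall x, forall n, absS (fn (h n) x) <= absS (fn g x)} ->
    {ae mu, forall x, (fun n => absS (fn (h n) x)) @ \oo --> 0} ->
  (fun n => rnorm (h n)) @ \oo --> 0.
Proof.
move=> hg h0.
have mh n := measurable_absS (fnM (h n)).
have mg := measurable_absS (fnM g).
have ig : mu.-integrable [set: T] (fun x => (absS (fn g x))%:E).
  apply/integrableP; split => //; apply: le_lt_trans (fnP g).2.
  apply: ge0_le_integral => //; first exact: measurableT_comp.
  by move=> x _ /=; rewrite ger0_norm ?absS_ge0.
have h0' : {ae mu, forall x, [set: T] x ->
    (fun n => (absS (fn (h n) x))%:E) @ \oo --> (0 : \bar R)%E}.
  by apply: filterS h0 => x hx _; apply: cvg_EFin; [exact: nearW|exact: hx].
have hg' : {ae mu, forall x n, [set: T] x ->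
    (`|(absS (fn (h n) x))%:E| <= (absS (fn g x))%:E)%E}.
  apply: filterS hg => x hx n _.
  by rewrite /= ger0_norm ?absS_ge0// lee_fin.
have [_ _] := dominated_convergence measurableT mh (measurable_cst (0 : \bar R)%E) h0' ig hg'.
rewrite integral0 => /fine_cvg /=; apply: cvg_trans.
apply: near_eq_cvg; apply: nearW => n /=.
by rewrite -[LHS]/(fine (L1int mu (fn (h n)))) -rnorm_int.
Qed.

Lemma cvg0_le (u : nat -> R) (e : R) : (u @ \oo --> (0 : R)) -> 0 < e ->
  exists N, forall n, (N <= n)%N -> u n < e.
Proof.
move=> u0 e0; have [N _ hN] := cvgr_lt _ u0 e e0.
by exists N => n Nn; apply: hN.
Qed.

Lemma cvg_dist (r : nat -> R) (l : R) : r @ \oo --> l ->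
  (fun n => `|l - r n|) @ \oo --> (0 : R).
Proof.
by move=> rl; have := cvg_norm (cvgB (cvg_cst l) rl); rewrite subrr normr0; exact.
Qed.

(** * Density of the products with simple functions *)

Definition approx f h := forall e : R, 0 < e ->
  exists p : part T, exists v : idx p -> K, rnorm (h - step v f) < e.

Lemma approxD f g h : approx f g -> approx f h -> approx f (g + h).
Proof.
move=> ag ah e e0; have e20 : 0 < e / 2 by rewrite divr_gt0.
have [p [v hv]] := ag _ e20; have [q [w hw]] := ah _ e20.
have [c hc] := common_l p q; have [c' hc'] := common_r p q.
exists (common p q), (fun j => v (c j) + w (c' j)).
have -> : step (fun j => v (c j) + w (c' j)) f = step v f + step w f.
  rewrite (step_refine v f hc) (step_refine w f hc') -big_split/=.
  by apply: eq_bigr => j _; rewrite scalerDl.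
rewrite opprD addrACA (le_lt_trans (rnormD _ _))//.
by rewrite (splitr e) ltrD.
Qed.

Lemma approxZ f g (a : K) : approx f g -> approx f (a *: g).
Proof.
move=> ag e e0; have a1 : 0 < absS a + 1 by rewrite ltr_wpDl// absS_ge0.
have [p [v hv]] := ag (e / (absS a + 1)) (divr_gt0 e0 a1).
exists p, (fun j => a * v j).
have -> : step (fun j => a * v j) f = a *: step v f.
  by rewrite scaler_sumr; apply: eq_bigr => j _; rewrite scalerA.
rewrite -scalerBr rnormZ (le_lt_trans (y := (absS a + 1) * rnorm (g - step v f)))//.
  by rewrite ler_wpM2r ?rnorm_ge0// lerDl.
by rewrite mulrC -ltr_pdivlMr.
Qed.

Lemma nnsfun_part (s : {nnsfun T >-> R}) :
  exists p : part T, exists v : idx p -> R, forall x, v (lab p x) = s x.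
Proof.
have /finite_seqP[l El] := fimfunP s.
have sl x : s x \in l.
  by have : range s (s x); [exists x|rewrite El].
pose lb x : seq_sub l := SeqSub (sl x).
have mlb j : measurable_fun [set: T] (fun x => lb x == j).
  have -> : (fun x => lb x == j) = (fun x => x \in s @^-1` [set ssval j]).
    apply/funext => x; rewrite -val_eqE /=; apply/eqP/idP => [e|/set_mem//].
    exact/mem_set.
  by apply: measurable_mem; exact: measurable_funPTI.
by exists (Part mlb), (fun j => ssval j).
Qed.

(** Simple functions increasing to u give products which stay below h and
   converge to it pointwise. *)
Lemma approx_pos f h (u : T -> R) : measurable_fun [set: T] u ->
    (forall x, 0 <= u x) ->
    {ae mu, forall x, fn h x = ofR (u x) * fn f x} ->
  approx f h.
Proof.
move=> mu' u0 hu e e0.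
have mu1 : measurable_fun [set: T] (EFin \o u) by apply/measurable_EFinP.
pose s := nnsfun_approx measurableT mu1.
have s_cvg x : (fun n => s n x) @ \oo --> u x.
  have := @cvg_nnsfun_approx _ _ _ _ measurableT _ mu1 (fun x _ => u0 x) x I.
  by move=> /fine_cvg; exact.
have s_u n x : s n x <= u x.
  have nd : nondecreasing_seq (fun n => s n x).
    move=> i j ij.
    by have /lefP := @nd_nnsfun_approx _ _ _ _ measurableT _ mu1 i j ij.
  have := nondecreasing_cvgn_le nd (cvgP _ (s_cvg x)) n.
  by have /cvg_lim -> := s_cvg x.
have st n : {h' : L | {ae mu, forall x, fn h' x = ofR (s n x) * fn f x} &
    exists p : part T, exists v : idx p -> K, h' = step v f}.
  apply/cid2; have [p [v hv]] := nnsfun_part (s n).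
  exists (step (fun j => ofR (v j)) f); last by exists p, (fun j => ofR (v j)).
  by apply: filterS (fn_step (fun j => ofR (v j)) f) => x ->; rewrite hv.
pose h' n := s2val (st n).
have fh' : {ae mu, forall x, forall n, fn (h - h' n) x = ofR (u x - s n x) * fn f x}.
  apply/ae_foralln => n.
  apply: filterS2 (filterI hu (s2valP (st n))) (filterI (fnD h (- h' n)) (fnZ (-1) (h' n))).
  move=> x [e1 e2] [-> e3]; rewrite -scaleN1r e3 e1 /h' e2 mulN1r -mulrBl.
  by rewrite ofRD ofRN.
have : (fun n => rnorm (h - h' n)) @ \oo --> (0 : R).
  apply: (@L1_dct _ h).
    apply: filterS2 hu fh' => x e1 e2 n; rewrite e1 e2 !absSM !absS_ofR.
    rewrite ler_wpM2r ?absS_ge0// !ger0_norm ?subr_ge0//.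
    by rewrite lerBlDr lerDl.
  apply: filterS fh' => x ex; under eq_fun do rewrite ex absSM absS_ofR.
  have h1 : (fun n => `|u x - s n x|) @ \oo --> (0 : R).
    exact: cvg_dist (s_cvg x).
  have := cvgM h1 (cvg_cst (absS (fn f x))); rewrite mul0r; exact.
move=> /cvg0_le /(_ e0)[N /(_ N (leqnn N))].
have [p [v hv]] := s2valP' (st N).
by exists p, v; rewrite -hv.
Qed.

Lemma good_le (p : T -> K) g : measurable_scalar p ->
  {ae mu, forall x, absS (p x) <= absS (fn g x)} -> good mu p.
Proof.
move=> mp pg; split => //; apply: le_lt_trans (fnP g).2.
apply: ae_ge0_le_integral => //.
- by move=> x _; rewrite lee_fin absS_ge0.
- exact: measurable_absS.
- by move=> x _; rewrite lee_fin absS_ge0.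
- exact: measurable_absS (fnM g).
- by apply: filterS pg => x e _; rewrite lee_fin.
Qed.

(** The quotient of h by f is measurable, and its real and imaginary parts are
   differences of nonnegative functions. *)
Lemma approx_supp f h : rs (supp f) h = h -> approx f h.
Proof.
move=> hS.
pose w x := fn h x / fn f x.
have mw : measurable_scalar w.
  by apply: measurable_scalar_mul; [exact: fnM|exact/measurable_scalar_inv/fnM].
have hw : {ae mu, forall x, fn h x = w x * fn f x}.
  have := fn_rs (supp f) h; rewrite hS; apply: filterS => x e.
  rewrite /w; have [f0|f0] := eqVneq (fn f x) 0; last by rewrite divfK.
  by rewrite f0 mulr0 e /= f0 eqxx mul0r.
have piece (u : T -> R) : measurable_fun [set: T] u -> (forall x, u x <= absS (w x)) ->
    {h' : L | {ae mu, forall x, fn h' x = ofR (Num.max 0 (u x)) * fn f x} & approx f h'}.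
  move=> mu' uw.
  have mu0 : measurable_fun [set: T] (fun x => Num.max 0 (u x)).
    by apply: measurable_maxr => //; exact: measurable_cst.
  have gu : good mu (fun x => ofR (Num.max 0 (u x)) * fn f x).
    apply: (@good_le _ h).
      by apply: measurable_scalar_mul; [exact: measurable_scalar_ofR|exact: fnM].
    apply: filterS hw => x ->; rewrite absSM (absSM (w x)) ler_wpM2r ?absS_ge0// absS_ofR.
    rewrite ger0_norm; last by rewrite le_max lexx.
    by rewrite ge_max; apply/andP; split; [exact: absS_ge0|exact: uw].
  exists (L1of mu (fun x => ofR (Num.max 0 (u x)) * fn f x)); first exact: fn_of.
  by apply: approx_pos (fn_of gu) => // x; rewrite le_max lexx.
have [mr mi] := mw.
have rew x : reS (w x) <= absS (w x) by exact: reS_le.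
have rew' x : - reS (w x) <= absS (w x) by rewrite (le_trans _ (norm_reS _))// -normrN ler_norm.
have imw x : imS (w x) <= absS (w x) by rewrite (le_trans _ (norm_imS _))// ler_norm.
have imw' x : - imS (w x) <= absS (w x) by rewrite (le_trans _ (norm_imS _))// -normrN ler_norm.
have [h1 e1 a1] := piece _ mr rew.
have [h2 e2 a2] := piece _ (measurable_funN mr) rew'.
have [h3 e3 a3] := piece _ mi imw.
have [h4 e4 a4] := piece _ (measurable_funN mi) imw'.
suff -> : h = h1 + (-1) *: h2 + iS *: (h3 + (-1) *: h4).
  by apply: approxD; [|apply: approxZ]; apply: approxD => //; exact: approxZ.
apply: L1_ext; near=> x.
have -> : fn (h1 + (-1) *: h2 + iS *: (h3 + (-1) *: h4)) x =
    fn (h1 + (-1) *: h2) x + fn (iS *: (h3 + (-1) *: h4)) x by near: x; exact: fnD.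
have -> : fn (iS *: (h3 + (-1) *: h4)) x = iS * fn (h3 + (-1) *: h4) x by near: x; exact: fnZ.
have -> : fn (h3 + (-1) *: h4) x = fn h3 x + fn ((-1) *: h4) x by near: x; exact: fnD.
have -> : fn (h1 + (-1) *: h2) x = fn h1 x + fn ((-1) *: h2) x by near: x; exact: fnD.
have -> : fn ((-1) *: h2) x = -1 * fn h2 x by near: x; exact: fnZ.
have -> : fn ((-1) *: h4) x = -1 * fn h4 x by near: x; exact: fnZ.
have -> : fn h1 x = ofR (Num.max 0 (reS (w x))) * fn f x by near: x; exact: e1.
have -> : fn h2 x = ofR (Num.max 0 (- reS (w x))) * fn f x by near: x; exact: e2.
have -> : fn h3 x = ofR (Num.max 0 (imS (w x))) * fn f x by near: x; exact: e3.
have -> : fn h4 x = ofR (Num.max 0 (- imS (w x))) * fn f x by near: x; exact: e4.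
have -> : fn h x = w x * fn f x by near: x; exact: hw.
have pm (r : R) : r = Num.max 0 r - Num.max 0 (- r).
  by rewrite !maxEle; case: (lerP 0 r); case: (lerP 0 (- r)) => *; lra.
rewrite {1}(scalarE (w x)) {1}(pm (reS (w x))) {1}(pm (imS (w x))) !ofRD !ofRN.
by ring.
Unshelve. all: by end_near. Qed.

(** On a step function the cells contribute additively to the norm of L1, so an
   estimate on the restrictions of f passes to step functions, and then by
   density to all functions carried by the support of f. *)
Lemma dense_bound (Y : normedModType K) (F : {linear L -> Y}) (C C' : R) f :
    (forall h, rnorm (F h) <= C' * rnorm h) -> 0 <= C' -> 0 <= C ->
    (forall B, rnorm (F (rs B f)) <= C * rnorm (rs B f)) ->
  forall h, rs (supp f) h = h -> rnorm (F h) <= C * rnorm h.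
Proof.
move=> bF C'0 C0 hF h hS; apply/ler_addgt0Pl => e e0.
have c0 : 0 < C + C' + 1 by rewrite ltr_wpDl// addr_ge0.
have [p [v hv]] := approx_supp hS (divr_gt0 e0 c0).
move: hv; rewrite ltr_pdivlMr// => hv.
have E : rnorm (F (step v f)) <= C * rnorm (step v f).
  rewrite rnorm_step mulr_sumr /step linear_sum (le_trans (rnorm_sum _ _ _))//.
  apply: ler_sum => j _; rewrite linearZ rnormZ mulrCA.
  by rewrite ler_wpM2l ?absS_ge0.
have E1 : rnorm (F h) <= rnorm (F (step v f)) + C' * rnorm (h - step v f).
  rewrite -{1}(subrK (step v f) h) linearD addrC (le_trans (rnormD _ _))//.
  by rewrite lerD2l.
have E2 : rnorm (step v f) <= rnorm h + rnorm (h - step v f).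
  by rewrite rnormB -lerBlDl rnormB_le.
have := ler_wpM2l C0 E2; have := rnorm_ge0 (h - step v f); nra.
Qed.

(** * Completeness *)

Lemma geo_sum (n : nat) : \sum_(i < n) (2^-1 : R) ^+ i <= 2.
Proof.
suff -> : \sum_(i < n) (2^-1 : R) ^+ i = 2 - 2 * 2^-1 ^+ n.
  by rewrite gerBl mulr_ge0// exprn_ge0// invr_ge0.
elim: n => [|n ih]; first by rewrite big_ord0 expr0 mulr1 subrr.
by rewrite big_ord_recr /= ih exprS; field.
Qed.

Lemma bv_cvg (r : nat -> R) (G : R) :
    (forall n, \sum_(i < n) `|r i.+1 - r i| <= G) ->
  r @ \oo --> fine (limn_esup (EFin \o r)).
Proof.
move=> rG; pose w i := r i.+1 - r i.
have cw : cvgn (series w).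
  apply: normed_cvg; apply: nondecreasing_is_cvgn.
    by apply/nondecreasing_seqP => n; rewrite /= /series /= big_nat_recr//= lerDl.
  by exists G => _ [n _ <-]; rewrite /= /series /= big_mkord.
have rE n : r n = series w n + r 0%N.
  by rewrite /series /= telescope_sumr// subrK.
have cr : r @ \oo --> limn (series w) + r 0%N.
  have h q : series w \+ cst (r 0%N) = q -> q @ \oo --> limn (series w) + r 0%N.
    by move=> <-; apply: cvgD; [exact: cw|exact: cvg_cst].
  by apply: h; apply/funext => n; rewrite [RHS]rE.
suff -> : limn_esup (EFin \o r) = (limn (series w) + r 0%N)%:E by [].
apply: (cvg_limn_einf_sup _).2.
by apply: cvg_EFin; [exact: nearW|exact: cr].
Qed.

Lemma absS_sum (I : Type) (s : seq I) (F : I -> K) :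
  absS (\sum_(i <- s) F i) <= \sum_(i <- s) absS (F i).
Proof. exact: (@rnorm_sum R k K^o I s predT F). Qed.

(** Upper limits exist, and are measurable in a parameter, without any
   assumption of convergence. *)
Definition limK (z : nat -> K) : K :=
  ofR (fine (limn_esup (EFin \o (reS \o z)))) +
  iS * ofR (fine (limn_esup (EFin \o (imS \o z)))).

Lemma bv_cvgK (z : nat -> K) (G : R) :
    (forall n, \sum_(i < n) absS (z i.+1 - z i) <= G) ->
  ((fun n => absS (limK z - z n)) @ \oo --> 0) /\
  forall n, absS (limK z - z n) <= G.
Proof.
move=> zG.
have cr : (reS \o z) @ \oo --> fine (limn_esup (EFin \o (reS \o z))).
  apply: (@bv_cvg _ G) => n; apply: le_trans (zG n); apply: ler_sum => i _ /=.
  by rewrite -reSB norm_reS.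
have ci : (imS \o z) @ \oo --> fine (limn_esup (EFin \o (imS \o z))).
  apply: (@bv_cvg _ G) => n; apply: le_trans (zG n); apply: ler_sum => i _ /=.
  by rewrite -imSB norm_imS.
set lr := fine _ in cr; set li := fine _ in ci.
have rl : reS (limK z) = lr by rewrite reSD reS_ofR reS_iS addr0.
have il n : `|imS (limK z) - imS (z n)| <= `|li - imS (z n)|.
  rewrite imSD imS_ofR add0r mulrC imSZ -/li.
  have [->|h0] := @imS_iS R k; first by rewrite mulr1.
  by rewrite !h0 mulr0 subrr normr0.
have c0 : (fun n => absS (limK z - z n)) @ \oo --> 0.
  apply: (@squeeze_cvgr _ _ _ _ (cst 0) (fun n => `|lr - reS (z n)| + `|li - imS (z n)|)).
  - apply: nearW => n; rewrite absS_ge0 /= (le_trans (absS_le_reim _))//.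
    by rewrite reSB imSB rl lerD2l.
  - exact: cvg_cst.
  - by have := cvgD (cvg_dist cr) (cvg_dist ci); rewrite addr0; exact.
split=> // n; apply/ler_addgt0Pl => e e0.
have [N hN] := cvg0_le c0 e0.
have := hN (maxn N n) (leq_maxl _ _); set m := maxn N n => hm.
rewrite -(subrK (z m) (limK z)) -addrA (le_trans (ler_absSD _ _))//.
rewrite lerD ?(ltW hm)//.
have nm : (n <= m)%N by exact: leq_maxr.
rewrite -(telescope_sumr _ nm) (le_trans (absS_sum _ _))//.
apply: le_trans (zG m); rewrite -(big_mkord xpredT (fun i => absS (z i.+1 - z i))).
by rewrite [leRHS](big_cat_nat (leq0n n) nm)//= lerDr sumr_ge0// => i _; exact: absS_ge0.
Qed.

(** Riesz-Fischer: the increments are dominated by an integrable function, so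
   the sequence converges almost everywhere and dominated convergence applies. *)
Lemma complete_fast (u : nat -> L) :
    (forall n, rnorm (u n.+1 - u n) <= 2^-1 ^+ n) ->
  exists l, (fun n => rnorm (l - u n)) @ \oo --> 0.
Proof.
move=> hu; pose w n := u n.+1 - u n.
pose G0 x := (\sum_(n <oo) (absS (fn (w n) x))%:E)%E.
have mw n : measurable_fun [set: T] (fun x => (absS (fn (w n) x))%:E).
  exact: measurable_absS (fnM (w n)).
have w0 n x : (0 <= (absS (fn (w n) x))%:E)%E by rewrite lee_fin absS_ge0.
have mG0 : measurable_fun [set: T] G0 by apply: ge0_emeasurable_sum.
have G00 x : (0 <= G0 x)%E by apply: nneseries_ge0.
have iG0 : (\int[mu]_x G0 x < +oo)%E.
  rewrite integral_nneseries//; apply: (@le_lt_trans _ _ 2%:E); last exact: ltry.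
  have E n : (\int[mu]_x (absS (fn (w n) x))%:E = (rnorm (w n))%:E)%E by rewrite rnorm_int.
  rewrite (eq_eseriesr (fun n _ => E n)).
  apply: lime_le; first by apply: is_cvg_nneseries => n _ _; rewrite lee_fin rnorm_ge0.
  apply: nearW => n; rewrite sumEFin lee_fin (le_trans _ (geo_sum n))// big_mkord.
  by apply: ler_sum => i _; exact: hu.
have G0fin : {ae mu, forall x, G0 x \is a fin_num}.
  have ig : mu.-integrable [set: T] G0.
    apply/integrableP; split => //.
    by under eq_integral do rewrite gee0_abs//.
  by have := integrable_ae measurableT ig; apply: filterS => x; exact.
have wE : {ae mu, forall x, forall n, fn (w n) x = fn (u n.+1) x - fn (u n) x}.
  apply/ae_foralln => n.
  apply: filterS2 (fnD (u n.+1) (- u n)) (fnZ (-1) (u n)) => x e1 e2.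
  by rewrite e1 -scaleN1r e2 mulN1r.
pose phi x := limK (fun n => fn (u n) x).
have hphi : {ae mu, forall x,
    ((fun n => absS (phi x - fn (u n) x)) @ \oo --> 0) /\
    forall n, absS (phi x - fn (u n) x) <= fine (G0 x)}.
  apply: filterS2 G0fin wE => x Gx wx; apply: bv_cvgK => n.
  rewrite -lee_fin fineK// -sumEFin.
  under eq_bigr do rewrite -wx.
  rewrite -(big_mkord xpredT (fun i => (absS (fn (w i) x))%:E)).
  exact: nneseries_lim_ge.
have mphi : measurable_scalar phi.
  have ml (p : nat -> T -> R) : (forall n, measurable_fun [set: T] (p n)) ->
      measurable_fun [set: T] (fun x => fine (limn_esup (EFin \o p^~ x))).
    move=> mp; apply: measurableT_comp => //.
    by apply: measurable_fun_limn_esup => n; apply/measurable_EFinP.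
  have mr := ml _ (fun n => (fnM (u n)).1); have mi := ml _ (fun n => (fnM (u n)).2).
  rewrite (_ : phi = fun x => iS * ofR (fine (limn_esup (EFin \o (fun n => imS (fn (u n) x))))) +
     ofR (fine (limn_esup (EFin \o (fun n => reS (fn (u n) x)))))); last first.
    by apply/funext => x; rewrite addrC.
  by apply: measurable_scalarMD; exact: measurable_scalar_ofR.
have gG : good mu (fun x => ofR (fine (G0 x)) : K).
  split; first by apply: measurable_scalar_ofR; exact: measurableT_comp.
  apply: le_lt_trans iG0; apply: ae_ge0_le_integral => //.
  - by move=> x _; rewrite lee_fin absS_ge0.
  - apply: measurable_absS; apply: measurable_scalar_ofR; exact: measurableT_comp.
  - by apply: filterS G0fin => x Gx _; rewrite absS_ofR ger0_norm ?fine_ge0// fineK.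
pose g := L1of mu (fun x => ofR (fine (G0 x)) : K).
have fg : {ae mu, forall x, absS (fn g x) = fine (G0 x)}.
  by apply: filterS (fn_of gG) => x ->; rewrite absS_ofR ger0_norm// fine_ge0.
have gp : good mu (fun x => -1 * fn (u 0%N) x + phi x).
  apply: (@good_le _ g); first by apply: measurable_scalarMD => //; exact: fnM.
  apply: filterS2 hphi fg => x [_ h] ->.
  by rewrite mulN1r addrC; exact: h.
pose l := L1of mu (fun x => -1 * fn (u 0%N) x + phi x) + u 0%N.
have fl : {ae mu, forall x, forall n, fn (l - u n) x = phi x - fn (u n) x}.
  apply/ae_foralln => n.
  apply: filterS2 (filterI (fn_of gp) (fnD (L1of mu (fun x => -1 * fn (u 0%N) x + phi x)) (u 0%N)))
    (filterI (fnD l (- u n)) (fnZ (-1) (u n))) => x [e1 e2] [e3 e4].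
  by rewrite e3 /l e2 e1 -(scaleN1r (u n)) e4 !mulN1r [- _ + phi x]addrC subrK.
exists l; apply: (@L1_dct _ g).
  by apply: filterS3 hphi fg fl => x [_ h] -> e n; rewrite e.
by apply: filterS2 hphi fl => x [h _] e; under eq_fun do rewrite e.
Qed.

(** * Hahn decomposition *)

Definition msub A B := forall x, A x -> B x.

(** The set function sending B to the real part of F (rs B f) is a charge: what
   remains of f after n pieces tends to 0 in norm by dominated convergence. *)
Lemma hahn (F : {linear L -> K^o}) (C : R) f : 0 <= C ->
    (forall h, absS (F h) <= C * rnorm h) ->
  exists D : mset T,
    (forall B, msub B D -> 0 <= reS (F (rs B f))) /\
    (forall B, msub B (msC D) -> reS (F (rs B f)) <= 0).
Proof.
move=> C0 bF.
pose nu0 (A : set T) : R := if pselect (measurable A) is left mA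
  then reS (F (rs (Mset (measurable_mem mA)) f)) else 0.
pose nu (A : set T) := (nu0 A)%:E.
have nuE (B : mset T) (A : set T) : measurable A -> (forall x, B x = (x \in A)) ->
    nu A = (reS (F (rs B f)))%:E.
  move=> mA BA; rewrite /nu /nu0; case: pselect => // mA'; congr ((reS (F _))%:E).
  by apply: eq_rs => x /=; rewrite BA.
have nu00 : nu set0 = 0%E.
  have [B hB] := mset_set (@measurable0 _ T).
  rewrite (nuE B)// (_ : rs B f = 0) ?linear0 ?reS0//.
  apply: L1_ext; apply: filterS2 (fn_rs B f) (@fn0 R k d T mu) => x -> ->.
  by rewrite hB in_set0 mul0r.
have nufin (A : set T) : measurable A -> nu A \is a fin_num by [].
have nusig : semi_sigma_additive nu.
  move=> A mA tA mU.
  have [U hU] := mset_set mU.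
  have [B hB] : {B : nat -> mset T | forall n x, B n x = (x \in A n)}.
    by exists (fun n => sval (mset_set (mA n))) => n; case: (mset_set (mA n)).
  pose h n := rs U f - \sum_(i < n) rs (B i) f.
  have hE : {ae mu, forall x n, fn (h n) x = ((U x)%:R - \sum_(i < n) (B i x)%:R) * fn f x}.
    apply/ae_foralln => n.
    have FB : {ae mu, forall x, forall i : 'I_n, fn (rs (B i) f) x = (B i x)%:R * fn f x}.
      by apply: filter_forall => i; exact: fn_rs.
    apply: filterS2 (filterI (fn_rs U f) (filterI FB (fn_sum (index_enum _) predT (fun i : 'I_n => rs (B i) f))))
      (filterI (fnD (rs U f) (- \sum_(i < n) rs (B i) f)) (fnZ (-1) (\sum_(i < n) rs (B i) f))).
    move=> x [e1 [e2 e3]] [e4 e5]; rewrite /h e4 e1 -(scaleN1r (\sum_(i < n) rs (B i) f)) e5 e3 mulN1r mulrBl mulr_suml.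
    by congr (_ - _); apply: eq_bigr => i _; rewrite e2.
  have coef x : exists N, forall n, (U x)%:R - \sum_(i < n) (B i x)%:R = ((n <= N)%N && U x)%:R :> K.
    rewrite hU; have [/set_mem [N _ AN]|xU] := boolP (x \in _).
      have B1 i : B i x = (i == N).
        rewrite hB; apply/idP/eqP => [/set_mem Ai|->]; last exact/mem_set.
        by apply: (tA i N) => //; exists x.
      exists N => n; rewrite andbT.
      under eq_bigr do rewrite B1.
      have [nN|Nn] := leqP n N.
        rewrite big1 ?subr0// => i _; rewrite (_ : (_ == _) = false)//.
        by apply/negbTE; rewrite neq_ltn (leq_trans (ltn_ord i)).
      rewrite (bigD1 (Ordinal Nn))//= eqxx big1 ?addr0 ?subrr// => i.
      by rewrite -val_eqE /= => /negbTE ->.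
    exists 0%N => n; rewrite andbF big1 ?subr0// => i _.
    rewrite hB (_ : (_ \in _) = false)//; apply/negbTE; apply: contra xU.
    by move=> /set_mem Ai; apply/mem_set; exists i.
  have h0 : (fun n => rnorm (h n)) @ \oo --> 0.
    apply: (@L1_dct _ f).
      apply: filterS hE => x e n; rewrite e; have [N ->] := coef x.
      by rewrite absSM absS_bool ler_piMl ?absS_ge0// lern1 leq_b1.
    apply: filterS hE => x e; have [N hN] := coef x.
    apply: cvg_near_cst; exists N.+1 => // n /= Nn.
    by rewrite e hN leqNgt Nn mul0r absS0.
  rewrite (nuE U)//.
  have -> : (fun n => (\sum_(0 <= i < n) nu (A i))%E) =
      EFin \o (fun n => reS (F (rs U f)) - reS (F (h n))).
    apply/funext => n /=; rewrite big_mkord.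
    under eq_bigr do rewrite (nuE (B _) _ (mA _) (hB _)).
    by rewrite sumEFin -reSB -linearB /h opprB addrC subrK linear_sum reS_sum.
  apply: cvg_EFin; first exact: nearW.
  rewrite -[X in _ --> X]subr0; apply: cvgB; first exact: cvg_cst.
  apply/cvgr0Pnorm_lt => e e0.
  have c0 : 0 < C + 1 by rewrite ltr_wpDl.
  have [N hN] := cvg0_le h0 (divr_gt0 e0 c0).
  exists N => // n /= /hN; rewrite ltr_pdivlMr// => hn.
  rewrite (le_lt_trans (norm_reS _))// (le_lt_trans (bF _))//.
  by rewrite (le_lt_trans _ hn)// mulrC ler_wpM2l ?rnorm_ge0// lerDl.
pose m := isCharge.Build _ T R nu nu00 nufin nusig.
pose nu' : {charge set T -> \bar R} := HB.pack nu m.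
have [P [N [[mP hP] [mN hN] PN PN0]]] := Hahn_decomposition nu'.
have [D hD] := mset_set mP; exists D; split=> B BD.
  have := hP _ (mset_measurable B); rewrite [X in (0 <= X)%E](nuE B)//; last 2 first.
  - exact: mset_measurable.
  - by move=> x; rewrite mem_setE.
  by rewrite lee_fin; apply => x /= /BD; rewrite hD => /set_mem.
have := hN _ (mset_measurable B); rewrite [X in (X <= 0)%E](nuE B)//; last 2 first.
- exact: mset_measurable.
- by move=> x; rewrite mem_setE.
rewrite lee_fin; apply => x /= /BD /=; rewrite hD => /negP xP.
have : (P `|` N) x by rewrite PN.
by case=> // Px; exfalso; apply: xP; exact/mem_set.
Qed.

End Analysis.

(** * The numerical index of L1 *)

Lemma align_phase {R : realType} {k} (w : scalar_field R k) :
  exists2 om : scalar_field R k, absS om = 1 &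
    forall r : R, 0 <= r -> absS (w + om * ofR r) = absS w + r.
Proof.
have [->|w0] := eqVneq w 0.
  exists 1; first exact: absS1.
  by move=> r r0; rewrite mul1r add0r absS0 add0r absS_ofR ger0_norm.
have aw : absS w != 0 by apply: contra_neq w0; exact: absS_eq0.
exists (w * ofR (absS w)^-1).
  by rewrite absSM absS_ofR ger0_norm ?invr_ge0 ?absS_ge0// divff.
move=> r r0; rewrite -mulrA -ofRM -[X in X + _]mulr1 -(@ofR1 R k) -mulrDr -ofRD.
rewrite absSM absS_ofR ger0_norm; first by rewrite mulrDr mulr1 mulrA divff// mul1r.
by rewrite addr_ge0// mulr_ge0// invr_ge0 absS_ge0.
Qed.

Section States.
Context {R : realType} {k : scalar_kind} {X : normedModType (scalar_field R k)}.
Local Notation K := (scalar_field R k).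
Implicit Types (x h : X) (phi : {linear X -> K^o}) (A : {linear X -> X}).

Lemma numstate_intro x phi : (forall h, absS (phi h) <= rnorm h) ->
  rnorm x = 1 -> phi x = 1 -> numstate x phi.
Proof.
move=> b x1 px.
have b1 h : rnorm (phi h) <= 1 * rnorm h by rewrite mul1r; exact: b.
have cphi : continuous phi by exact: (bounded_continuous b1).
split=> //; apply/eqP; rewrite eq_le opnorm_le//=.
have := rnorm_opnorm x cphi; rewrite x1 mulr1; apply: le_trans.
by rewrite px rnorm_absS absS1.
Qed.

Lemma numstate_bound x phi h : numstate x phi -> absS (phi h) <= rnorm h.
Proof.
by move=> [_ c n1 _]; have := rnorm_opnorm h c; rewrite n1 mul1r.
Qed.

Lemma le_numradius A x phi : continuous A -> numstate x phi ->
  absS (phi (A x)) <= numradius A.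
Proof.
move=> /continuous_bounded[C C0 bA] sx; apply: ub_le_sup; last by exists x, phi.
exists C => _ [y [psi [sy ->]]].
rewrite (le_trans (numstate_bound _ sy))// (le_trans (bA y))//.
by case: sy => -> _ _ _; rewrite mulr1.
Qed.

Lemma numradius_eq A x phi (C : R) : (forall h, rnorm (A h) <= C * rnorm h) ->
  numstate x phi -> absS (phi (A x)) = C -> numradius A = C.
Proof.
move=> bA sx E; apply/eqP; rewrite eq_le; apply/andP; split; last first.
  by rewrite -E le_numradius//; exact: bounded_continuous bA.
apply: ge_sup; first by exists (absS (phi (A x))), x, phi.
move=> _ [y [psi [sy ->]]]; rewrite (le_trans (numstate_bound _ sy))//.
by rewrite (le_trans (bA y))//; case: sy => -> _ _ _; rewrite mulr1.
Qed.

End States.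

Section NumIndex.
Context {R : realType} {k : scalar_kind} {d : measure_display}
  {T : measurableType d} {mu : {measure set T -> \bar R}}.
Local Notation K := (scalar_field R k).
Local Notation L := (L1 k mu).
Implicit Types (f g h : L) (B : mset T) (A : {linear L -> L}).

(** A functional which norms rs B f has to be the conjugate sign of f on the
   support of rs B f. Elsewhere it is free: the conjugate sign of the image, times
   a phase aligning the two contributions, makes their moduli add up. *)
Lemma piece_numradius A f B : continuous A ->
  absS (intK (Mul (mcsgn f) (rs (msI B (supp f)) (A (rs B f))))) +
    rnorm (rs (msC (msI B (supp f))) (A (rs B f))) <=
  numradius A * rnorm (rs B f).
Proof.
move=> cA; set E := msI B (supp f); set a := rs B f.
have [a0|a0] := eqVneq a 0.
  by rewrite a0 !linear0 !rnorm0 mulr0 -rnorm_absS rnorm0 addr0.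
have na0 : rnorm a != 0 by apply: contra_neq a0; exact: rnorm_eq0.
have nVa : 0 <= (rnorm a)^-1 by rewrite invr_ge0 rnorm_ge0.
set w := intK _; have [om om1 omw] := align_phase w.
have om1' : absS om <= 1 by rewrite om1.
pose m := mif E (mcsgn f) (mmul (mconst om1') (mcsgn (A a))).
have mE h : Mul m h = Mul (mcsgn f) (rs E h) +
    om *: Mul (mcsgn (A a)) (rs (msC E) h).
  apply: L1_ext; apply: filterS3 (filterI (fnMul m h) (filterI (fnMul (mcsgn f) (rs E h)) (fn_rs E h)))
    (filterI (fnMul (mcsgn (A a)) (rs (msC E) h)) (fn_rs (msC E) h))
    (filterI (fnD (Mul (mcsgn f) (rs E h)) (om *: Mul (mcsgn (A a)) (rs (msC E) h)))
       (fnZ om (Mul (mcsgn (A a)) (rs (msC E) h)))) => x [e1 [e2 e3]] [e4 e5] [e6 e7].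
  rewrite e1 e6 e7 e4 e5 e2 e3 /m /=.
  by case: (B x && _) => /=; rewrite ?mul1r ?mul0r ?mulr0 ?addr0 ?add0r ?mulrA.
have Ea : rs E a = a.
  by rewrite /E -rs_rs /a (rsC (supp f) B) rs_id rs_supp.
have Ca : rs (msC E) a = 0.
  by apply/eqP; rewrite -(inj_eq (addrI a)) addr0 -{1}Ea -rs_splits.
pose phi : {linear L -> K^o} := intK \o Mul m.
have phi_a : phi a = ofR (rnorm a).
  by rewrite /phi /= mE Ea Ca [Mul _ 0]linear0 scaler0 addr0 intK_csgn_rs.
have phi_Aa : phi (A a) = w + om * ofR (rnorm (rs (msC E) (A a))).
  by rewrite /phi /= mE linearD linearZ /= intK_csgn_rs.
have sx : numstate (ofR (rnorm a)^-1 *: a) phi.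
  apply: numstate_intro => [h||]; first exact: absS_intK_Mul.
    by rewrite rnormZ absS_ofR ger0_norm// mulVf.
  by rewrite linearZ phi_a -[LHS]/(ofR (rnorm a)^-1 * ofR (rnorm a)) -ofRM mulVf// ofR1.
have := le_numradius cA sx; rewrite !linearZ phi_Aa.
rewrite -[X in absS X]/(ofR (rnorm a)^-1 * (w + om * ofR (rnorm (rs (msC E) (A a))))).
rewrite absSM absS_ofR ger0_norm// omw ?rnorm_ge0//.
by rewrite mulrC ler_pdivrMr// lt_neqAle eq_sym na0 rnorm_ge0.
Qed.

Definition offdiag A f (p : part T) : R :=
  \sum_(j : idx p) rnorm (rs (msC (msI (cell j) (supp f))) (A (rs (cell j) f))).

Definition diag A f (p : part T) : L :=
  \sum_(j : idx p) rs (msI (cell j) (supp f)) (A (rs (cell j) f)).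

Lemma rnorm_sub B (B' : mset T) h : msub B B' ->
  rnorm (rs B' h) = rnorm (rs B h) + rnorm (rs (msI B' (msC B)) h).
Proof.
move=> BB; rewrite [LHS](rnorm_splits B) !rs_rs.
have e1 : msI B B' =1 B by move=> x /=; have := BB x; case: (B x) => //= ->.
have e2 : msI (msC B) B' =1 msI B' (msC B) by move=> x /=; rewrite andbC.
by rewrite (eq_rs h e1) (eq_rs h e2).
Qed.

Lemma rs_sub B (B' : mset T) h : msub B B' ->
  rs B' h = rs B h + rs (msI B' (msC B)) h.
Proof.
move=> BB; rewrite [LHS](rs_splits B) !rs_rs.
have e1 : msI B B' =1 B by move=> x /=; have := BB x; case: (B x) => //= ->.
have e2 : msI (msC B) B' =1 msI B' (msC B) by move=> x /=; rewrite andbC.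
by rewrite (eq_rs h e1) (eq_rs h e2).
Qed.

(** Refining the partition moves mass from the diagonal part to the off-diagonal
   one, and the diagonal part varies by no more than what is moved. *)
Lemma diag_refine A f p q (c : idx p -> idx q) : refines c ->
  rnorm (diag A f q - diag A f p) <= offdiag A f p - offdiag A f q.
Proof.
move=> pq; pose b i := A (rs (cell (p := p) i) f).
pose E i := msI (cell (p := p) i) (supp f); pose E' j := msI (cell (p := q) j) (supp f).
have EE i : msub (E i) (E' (c i)).
  by move=> x /= /andP[/eqP <- ->]; rewrite pq eqxx.
have Ab j : A (rs (cell j) f) = \sum_(i | c i == j) b i.
  by rewrite (rs_cell_sum j f pq) linear_sum.
have dq : diag A f q = \sum_i rs (E' (c i)) (b i).
  rewrite [RHS](partition_big c predT)//=; apply: eq_bigr => j _.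
  by rewrite Ab linear_sum; apply: eq_bigr => i /eqP <-.
have op : offdiag A f p = \sum_i rnorm (rs (msC (E' (c i))) (b i)) +
    \sum_i rnorm (rs (msI (E' (c i)) (msC (E i))) (b i)).
  rewrite -big_split /=; apply: eq_bigr => i _.
  rewrite (@rnorm_sub (msC (E' (c i)))); last first.
    by move=> x; apply: contra => /EE.
  by congr (_ + rnorm _); apply: eq_rs => x /=; rewrite negbK andbC.
have oq : offdiag A f q <= \sum_i rnorm (rs (msC (E' (c i))) (b i)).
  rewrite [leRHS](partition_big c predT)//=; apply: ler_sum => j _.
  rewrite Ab linear_sum (le_trans (rnorm_sum _ _ _))//.
  by apply: ler_sum => i /eqP <-.
rewrite dq /diag -sumrB (le_trans (rnorm_sum _ _ _))//.
rewrite lerBrDr op addrC; apply: lerD => //.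
apply: ler_sum => i _.
by rewrite (rs_sub _ (EE i)) addrC addKr.
Qed.

(** The off-diagonal mass is bounded and increases under refinement, so the
   diagonal part stabilizes along fine partitions. It is then almost constant
   relatively to f on each cell, so that integrating it there against the sign of
   f loses almost nothing of its norm, and the estimates of piece_numradius for
   the cells add up to the norm of the image of f. *)
Theorem rnorm_numradius A f : continuous A ->
  rnorm (A f) <= numradius A * rnorm f.
Proof.
move=> cA; have [C C0 bA] := continuous_bounded cA.
apply/ler_addgt0Pl => e0 e0p; rewrite -(divfK (_ : 4 != 0 :> R) e0)//.
set e := e0 / 4; have ep : 0 < e by rewrite divr_gt0.
pose O := [set r | exists p : part T, r = offdiag A f p].
have supO : has_sup O.
  split; first by exists (offdiag A f trivial_part), trivial_part.
  exists (C * rnorm f) => _ [p ->].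
  rewrite (rnorm_cells p f) mulr_sumr; apply: ler_sum => j _.
  exact: le_trans (rnorm_rs _ _) (bA _).
have [_ [p0 ->] p0e] := sup_adherent ep supO.
have S0 : rs (supp f) (diag A f p0) = diag A f p0.
  rewrite /diag linear_sum /=; apply: eq_bigr => j _; rewrite rs_rs.
  by apply: eq_rs => x /=; rewrite andbCA andbb.
have [p1 [v hv]] := approx_supp S0 ep.
pose p := common p0 p1.
have [c0 hc0] := common_l p0 p1; have [c1 hc1] := common_r p0 p1.
pose s := step (v \o c1) f.
have pe : rnorm (diag A f p0 - diag A f p) <= e.
  rewrite (le_trans (diag_refine _ _ hc0))// lerBlDr.
  have : offdiag A f p <= sup O by apply: ub_le_sup; [exact: supO.2|by exists p].
  by move=> /le_trans; apply; rewrite -lerBlDl ltW.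
have se : rnorm (diag A f p - s) <= 2 * e.
  rewrite -(subrK (diag A f p0) (diag A f p)) -addrA (le_trans (rnormD _ _))//.
  rewrite mulrDl mul1r lerD//; first by rewrite rnormB.
  by rewrite /s -(step_refine v f hc1) ltW.
have cd (j : idx p) : rs (cell j) (diag A f p) = rs (msI (cell j) (supp f)) (A (rs (cell j) f)).
  rewrite /diag linear_sum (bigD1 j)//= -rs_rs rs_id big1 ?addr0// => i ij.
  by rewrite -rs_rs rs_cell_cell eq_sym (negbTE ij).
have piece (j : idx p) : rnorm (A (rs (cell j) f)) <=
    numradius A * rnorm (rs (cell j) f) + 2 * rnorm (rs (cell j) (diag A f p - s)).
  have := piece_numradius f (cell j) cA; rewrite /= -cd.
  rewrite (rnorm_splits (msI (cell j) (supp f)) (A _)) -cd.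
  set r1 := rnorm (rs (msC _) _).
  have h1 : rnorm (rs (cell j) (diag A f p)) <= rnorm (rs (cell j) s) +
      rnorm (rs (cell j) (diag A f p - s)).
    by rewrite -lerBlDl linearB rnormB_le.
  have h2 : rnorm (rs (cell j) s) <= absS (intK (Mul (mcsgn f) (rs (cell j) (diag A f p)))) +
      rnorm (rs (cell j) (diag A f p - s)).
    have -> : rnorm (rs (cell j) s) = absS (intK (Mul (mcsgn f) (rs (cell j) s))).
      rewrite rs_step rnormZ [Mul _ _]linearZ /= [intK _]linearZ /= intK_csgn_rs.
      by rewrite absSM absS_ofR ger0_norm ?rnorm_ge0.
    rewrite -lerBlDl; apply: le_trans (absS_intK_Mul (mcsgn f) _).
    rewrite [rs _ (_ - _)]linearB [Mul _ (_ - _)]linearB [intK (_ - _)]linearB.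
    by rewrite -rnorm_absS -[X in _ - X]rnorm_absS -rnorm_absS rnormB rnormB_le.
  lra.
rewrite {1}(rs_cells p f) linear_sum (le_trans (rnorm_sum _ _ _))//.
apply: (@le_trans _ _ (\sum_(j : idx p) (numradius A * rnorm (rs (cell j) f) +
    2 * rnorm (rs (cell j) (diag A f p - s))))); first exact: ler_sum.
rewrite big_split /= -!mulr_sumr -(rnorm_cells p f) -(rnorm_cells p (diag A f p - s)) addrC lerD2r.
by rewrite (le_trans (ler_wpM2l _ se))// mulrA; lra.
Qed.

(** The difference of the two functionals is small on the restrictions of f, to
   which dense_bound applies. *)
Lemma close_csgn (F : {linear L -> K^o}) (C kap : R) f : 0 <= C -> 0 <= kap ->
    (forall h, absS (F h) <= C * rnorm h) ->
    (forall B, absS (F (rs B f) - ofR (rnorm (rs B f))) <= kap * rnorm (rs B f)) ->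
  forall h, rs (supp f) h = h ->
    absS (F h - intK (Mul (mcsgn f) h)) <= kap * rnorm h.
Proof.
move=> C0 k0 bF hF h hS.
have [G GE] : {G : {linear L -> K^o} | forall h, G h = F h - intK (Mul (mcsgn f) h)}.
  apply: lin_map_exists => a x y.
  by rewrite linearP [Mul _ _]linearP [intK _]linearP scalerBr opprD addrACA.
rewrite -GE -rnorm_absS; apply: (@dense_bound _ _ _ _ _ _ _ kap (C + 1)) hS => //.
- move=> g; rewrite GE rnorm_absS (le_trans (ler_absSD _ _))// absSN mulrDl mul1r.
  by rewrite lerD// absS_intK_Mul.
- by rewrite addr_ge0.
- by move=> B; rewrite GE intK_csgn_rs; exact: hF.
Qed.

End NumIndex.

(** * The positive part of an operator *)

Lemma absS1_neq0 {R : realType} {k} (z : scalar_field R k) : absS z = 1 -> z != 0.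
Proof.
by move=> z1; apply/eqP => z0; move: z1; rewrite z0 absS0 => /eqP; rewrite eq_sym oner_eq0.
Qed.

Section Positive.
Context {R : realType} {k : scalar_kind} {d : measure_display}
  {T : measurableType d} {mu : {measure set T -> \bar R}}.
Local Notation K := (scalar_field R k).
Local Notation L := (L1 k mu).
Implicit Types (f g h : L) (B : mset T).

(** A sequence of finer and finer partitions, chosen along geometric bounds,
   reduces the net to a sequence with summable increments. *)
Lemma complete_net (F : part T -> L) :
    (forall e : R, 0 < e -> exists p0, forall p, finer p p0 -> rnorm (F p - F p0) <= e) ->
  exists l, forall e : R, 0 < e -> exists p0, forall p, finer p p0 -> rnorm (F p - l) <= e.
Proof.
move=> cF.
have e0 n : 0 < (2^-1 : R) ^+ n / 2 by rewrite divr_gt0// exprn_gt0// invr_gt0.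
pose P n := sval (cid (cF _ (e0 n))).
have hP n p : finer p (P n) -> rnorm (F p - F (P n)) <= 2^-1 ^+ n / 2.
  by rewrite /P; case: cid => q hq; exact: hq.
have hP2 n p q : finer p (P n) -> finer q (P n) -> rnorm (F p - F q) <= 2^-1 ^+ n.
  move=> /hP hp /hP hq; rewrite -(subrK (F (P n)) (F p)) -addrA.
  rewrite (le_trans (rnormD _ _))// [leRHS]splitr lerD//.
  by rewrite rnormB.
pose pp := fix pp n := if n is m.+1 then common (pp m) (P m.+1) else P 0%N.
have ppP n : finer (pp n) (P n).
  by case: n => [|n]; [exact: finer_refl|exact: common_r].
have ppS n : finer (pp n.+1) (P n).
  by apply: finer_trans (ppP n); exact: common_l.
have [l hl] := complete_fast (fun n => hP2 n _ _ (ppS n) (ppP n)).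
exists l => e e0'; have e2 : 0 < e / 2 by rewrite divr_gt0.
have [N1 h1] := cvg0_le hl e2.
have c2 : (fun n => (2^-1 : R) ^+ n) @ \oo --> 0.
  by apply: cvg_expr; rewrite ger0_norm ?invr_ge0// invf_lt1// ltr1n.
have [N2 h2] := cvg0_le c2 e2.
pose n := maxn N1 N2; exists (pp n) => p /finer_trans/(_ (ppP n)) pn.
rewrite -(subrK (F (pp n)) (F p)) -addrA (le_trans (rnormD _ _))//.
rewrite [leRHS]splitr lerD//.
  by rewrite (le_trans (hP2 n _ _ pn (ppP n)))// ltW// h2// leq_maxr.
by rewrite rnormB ltW// h1// leq_maxl.
Qed.

Variable G : @mult R k d T.
Hypothesis Gu : forall x, G x = 0 \/ absS (G x) = 1.

(** The face of L1 normed by G: those h for which G h is nonnegative almost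
   everywhere. *)
Definition cone h := intK (Mul G h) = ofR (rnorm h).

Lemma cone0 : cone 0.
Proof. by rewrite /cone !linear0 rnorm0 ofR0. Qed.

(** G norms both summands, hence also their sum: there is no cancellation. *)
Lemma coneD f g : cone f -> cone g ->
  cone (f + g) /\ rnorm (f + g) = rnorm f + rnorm g.
Proof.
move=> cf cg.
have E : intK (Mul G (f + g)) = ofR (rnorm f + rnorm g) :> K.
  by rewrite !linearD ofRD -cf -cg.
have rE : rnorm (f + g) = rnorm f + rnorm g.
  apply/eqP; rewrite eq_le rnormD /=.
  have := absS_intK_Mul G (f + g).
  by rewrite E absS_ofR ger0_norm ?addr_ge0 ?rnorm_ge0.
by rewrite /cone rE E.
Qed.

Lemma cone_sum (I : Type) (s : seq I) (P : pred I) (F : I -> L) :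
    (forall i, P i -> cone (F i)) ->
  cone (\sum_(i <- s | P i) F i) /\
  rnorm (\sum_(i <- s | P i) F i) = \sum_(i <- s | P i) rnorm (F i).
Proof.
move=> cF; elim/big_rec2 : _ => [|i u v Pi [cv <-]].
  by rewrite rnorm0; split => //; exact: cone0.
exact: coneD (cF i Pi) cv.
Qed.

Lemma coneZ (r : R) h : 0 <= r -> cone h -> cone (ofR r *: h).
Proof.
move=> r0 ch; rewrite /cone !linearZ rnormZ absS_ofR ger0_norm// ofRM /= -ch.
by [].
Qed.

Lemma cone_lim h : (forall e : R, 0 < e -> exists2 g, cone g & rnorm (g - h) <= e) ->
  cone h.
Proof.
move=> hg; suff : absS (intK (Mul G h) - ofR (rnorm h)) <= 0.
  rewrite le_eqVlt ltNge absS_ge0 orbF => /eqP /absS_eq0 /eqP.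
  by rewrite subr_eq0 => /eqP.
apply/ler_addgt0Pl => e e0; rewrite addr0.
have e2 : 0 < e / 2 by rewrite divr_gt0.
have [g cg gh] := hg _ e2.
rewrite -(subrK (intK (Mul G g)) (intK (Mul G h))) {2}cg -addrA -ofRN -ofRD.
rewrite (le_trans (ler_absSD _ _))// (splitr e) lerD//.
  rewrite -[X in absS X](linearB intK) -linearB.
  by rewrite (le_trans (absS_intK_Mul _ _))// rnormB.
rewrite absS_ofR ler_norml; apply/andP; split.
  by rewrite lerNl opprB (le_trans (rnormB_le _ _))// rnormB.
by rewrite (le_trans (rnormB_le _ _)).
Qed.

Lemma good_posp h :
  good mu (fun x => (G x)^-1 * ofR (Num.max 0 (reS (G x * fn h x)))).
Proof.
apply: (@good_le _ _ _ _ _ _ h).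
  apply: measurable_scalar_mul; first exact/measurable_scalar_inv/mvalM.
  apply: measurable_scalar_ofR; apply: measurable_maxr; first exact: measurable_cst.
  by case: (good_mul G h) => -[].
apply: nearW => x; rewrite absSM absSV absS_ofR.
rewrite ger0_norm; last by rewrite le_max lexx.
case: (Gu x) => [->|G1]; first by rewrite absS0 invr0 mul0r absS_ge0.
rewrite G1 invr1 mul1r ge_max absS_ge0 /= (le_trans (reS_le _))//.
by rewrite absSM G1 mul1r.
Qed.

(** The function whose product with G is the positive part of the real part of
   G h; where G vanishes, so does its inverse. *)
Definition posp h : L :=
  L1of mu (fun x => (G x)^-1 * ofR (Num.max 0 (reS (G x * fn h x)))).

Lemma fn_posp h : {ae mu, forall x,
  fn (posp h) x = (G x)^-1 * ofR (Num.max 0 (reS (G x * fn h x)))}.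
Proof. exact: fn_of (good_posp h). Qed.

Lemma G_posp h : {ae mu, forall x,
  G x * fn (posp h) x = ofR (Num.max 0 (reS (G x * fn h x))) /\
  absS (fn (posp h) x) = Num.max 0 (reS (G x * fn h x))}.
Proof.
apply: filterS (fn_posp h) => x ->.
case: (Gu x) => [->|G1]; first by rewrite invr0 !mul0r reS0 maxxx ofR0 absS0.
have G0 : G x != 0 by apply: absS1_neq0.
split; first by rewrite mulrA divff// mul1r.
rewrite absSM absSV G1 invr1 mul1r absS_ofR ger0_norm//.
by rewrite le_max lexx.
Qed.

Lemma cone_posp h : cone (posp h).
Proof.
apply: intK_abs; apply: filterS2 (G_posp h) (fnMul G (posp h)) => x [e1 e2] ->.
by rewrite e1 e2.
Qed.

Lemma posp_le h : rnorm (posp h) <= rnorm h.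
Proof.
apply: le_rnorm; apply: filterS (G_posp h) => x [_ ->].
rewrite ge_max absS_ge0 (le_trans (reS_le _))// absSM.
by rewrite ler_piMl ?absS_ge0 ?mval_le1.
Qed.

Lemma posp0 : posp 0 = 0.
Proof. by apply: rnorm_eq0; apply/eqP; rewrite eq_le rnorm_ge0 -(@rnorm0 R k L) posp_le. Qed.

(** This subadditivity is what makes the discretized positive parts increase
   under refinement. *)
Lemma posp_sub (I : finType) (P : pred I) (F : I -> L) :
  cone (\sum_(i | P i) posp (F i) - posp (\sum_(i | P i) F i)).
Proof.
set S := \sum_(i | P i) F i; set S' := \sum_(i | P i) posp (F i).
have e1 : {ae mu, forall x, forall i,
   fn (posp (F i)) x = (G x)^-1 * ofR (Num.max 0 (reS (G x * fn (F i) x)))}.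
  by apply: filter_forall => i; exact: fn_posp.
apply: intK_abs.
apply: filterS2 (filterI (fnMul G (S' - posp S)) (filterI (fnD S' (- posp S)) (fnZ (-1) (posp S))))
  (filterI (filterI e1 (fn_posp S)) (filterI (fn_sum (index_enum I) P F) (fn_sum (index_enum I) P (fun i => posp (F i)))))
  => x [-> [-> e2]] [[e3 e4] [e5 e6]].
rewrite -(scaleN1r (posp S)) e2 mulN1r.
pose r i := reS (G x * fn (F i) x).
have -> : fn S' x - fn (posp S) x =
    (G x)^-1 * ofR (\sum_(i | P i) Num.max 0 (r i) - Num.max 0 (\sum_(i | P i) r i)).
  rewrite e4 /S e5 /S' e6 mulr_sumr ofRD ofRN ofR_sum reS_sum mulrBr mulr_sumr.
  by congr (_ - _); apply: eq_bigr => i _; rewrite e3.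
have E0 : 0 <= \sum_(i | P i) Num.max 0 (r i) - Num.max 0 (\sum_(i | P i) r i).
  rewrite subr_ge0 ge_max sumr_ge0 /=; last by move=> i _; rewrite le_max lexx.
  by apply: ler_sum => i _; rewrite le_max lexx orbT.
case: (Gu x) => G1; first by rewrite G1 invr0 !mul0r absS0 ofR0.
have G0 : G x != 0 by apply: absS1_neq0.
by rewrite mulrA divff// mul1r absSM absSV G1 invr1 mul1r absS_ofR ger0_norm.
Qed.

(** Put s for the modulus of z and w for s minus the real part of g z. The
   left-hand side is at most the square root of 2 s w, that is twice the geometric
   mean of t s and w / (2 t). *)
Lemma reim_amgm (t : R) (g z : K) : 0 < t -> g = 0 \/ absS g = 1 ->
  absS (z - g^-1 * ofR (Num.max 0 (reS (g * z)))) <=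
    t * absS z + (absS z - reS (g * z)) / (2 * t).
Proof.
move=> t0 gu.
set m := Num.max 0 _; set s := absS z; set D := absS (z - _).
pose w := s - reS (g * z).
have s0 : 0 <= s by exact: absS_ge0.
have gs : `|reS (g * z)| <= s.
  rewrite (le_trans (norm_reS _))// absSM; case: gu => [->|->].
    by rewrite absS0 mul0r.
  by rewrite mul1r.
have w0 : 0 <= w by rewrite subr_ge0 (le_trans (ler_norm _)).
have D2 : D ^+ 2 <= 2 * s * w.
  case: gu => g1.
    rewrite /D /w g1 invr0 !mul0r subr0 reS0 subr0 -/s; nra.
  have g0 : g != 0 by apply: absS1_neq0.
  have -> : D = absS (g * z - ofR m).
    rewrite /D -[LHS]mul1r -g1 -absSM mulrBr mulrA divff//; congr (absS (_ - _)).
    by rewrite mul1r.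
  have := absS_sqr (g * z); rewrite absSM g1 mul1r -/s.
  rewrite absS_sqr reSB imSB reS_ofR imS_ofR subr0 /w.
  move: gs; rewrite ler_norml /m; set a := reS _; set b := imS _ => /andP[g1' g2'].
  by rewrite maxEle; case: (lerP 0 a) => a0 E; nra.
have tw : 0 <= w / (2 * t) by rewrite divr_ge0// mulr_ge0// ltW.
have ts : 0 <= t * s by rewrite mulr_ge0// ltW.
rewrite -(@ler_pXn2r _ 2)// ?nnegrE ?absS_ge0 ?addr_ge0// -/w.
apply: le_trans D2 _.
have -> : 2 * s * w = 4 * (t * s) * (w / (2 * t)).
  by field; rewrite gt_eqF.
have := sqr_ge0 (t * s - w / (2 * t)); nra.
Qed.

(** The pointwise estimate is linear in the modulus and in the real part, hence
   can be integrated. *)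
Lemma posp_close (t : R) h : 0 < t ->
  rnorm (h - posp h) <= t * rnorm h + (rnorm h - reS (intK (Mul G h))) / (2 * t).
Proof.
move=> t0; pose q := ofR t *: labs h + ofR (2 * t)^-1 *: (labs h - Mul G h).
have -> : t * rnorm h + (rnorm h - reS (intK (Mul G h))) / (2 * t) = reS (intK q).
  rewrite /q linearD !linearZ /= linearB /= intK_labs.
  move: (intK (Mul G h)) => z.
  rewrite -[RHS]/(reS (ofR t * ofR (rnorm h) + ofR (2 * t)^-1 * (ofR (rnorm h) - z))).
  by rewrite reSD !reSZ reSB !reS_ofR [_^-1 * _]mulrC.
rewrite -[leLHS](@reS_ofR _ k) -intK_labs; apply: le_re_intK; near=> x.
have -> : fn (labs (h - posp h)) x = ofR (absS (fn (h - posp h) x)).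
  by near: x; exact: fn_labs.
have -> : fn (h - posp h) x = fn h x + fn (- posp h) x by near: x; exact: fnD.
have -> : fn (- posp h) x = -1 * fn (posp h) x.
  by near: x; rewrite -(scaleN1r (posp h)); exact: fnZ.
have -> : fn (posp h) x = (G x)^-1 * ofR (Num.max 0 (reS (G x * fn h x))).
  by near: x; exact: fn_posp.
have -> : fn q x = fn (ofR t *: labs h) x + fn (ofR (2 * t)^-1 *: (labs h - Mul G h)) x.
  by near: x; exact: fnD.
have -> : fn (ofR t *: labs h) x = ofR t * fn (labs h) x by near: x; exact: fnZ.
have -> : fn (ofR (2 * t)^-1 *: (labs h - Mul G h)) x = ofR (2 * t)^-1 * fn (labs h - Mul G h) x.
  by near: x; exact: fnZ.
have -> : fn (labs h - Mul G h) x = fn (labs h) x + fn (- Mul G h) x by near: x; exact: fnD.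
have -> : fn (- Mul G h) x = -1 * fn (Mul G h) x.
  by near: x; rewrite -(scaleN1r (Mul G h)); exact: fnZ.
have -> : fn (Mul G h) x = G x * fn h x by near: x; exact: fnMul.
have -> : fn (labs h) x = ofR (absS (fn h x)) by near: x; exact: fn_labs.
rewrite reS_ofR reSD !reSZ !mulN1r reSB !reS_ofR [(2 * t)^-1 * _]mulrC.
exact: reim_amgm.
Unshelve. all: by end_near. Qed.

End Positive.

Section PositiveOperator.
Context {R : realType} {k : scalar_kind} {d : measure_display}
  {T : measurableType d} {mu : {measure set T -> \bar R}}.
Local Notation K := (scalar_field R k).
Local Notation L := (L1 k mu).
Implicit Types (f g h : L) (B : mset T) (p q : part T).
Variable G : @mult R k d T.
Hypothesis Gu : forall x, G x = 0 \/ absS (G x) = 1.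
Variable A : {linear L -> L}.
Hypothesis A1 : forall f, rnorm (A f) <= rnorm f.
Variable a : L.

(** The positive part of the vector measure sending B to A (rs B a), before
   passing to the limit along partitions of B. *)
Definition nu B : L := posp G (A (rs B a)).

Lemma nu_le B : rnorm (nu B) <= rnorm (rs B a).
Proof. exact: le_trans (posp_le _ _) (A1 _). Qed.

Lemma nu_cone B : cone G (nu B). Proof. exact: cone_posp. Qed.

(** The mean value over the cell of the quotient of f by a, with respect to the
   measure of density the modulus of a. It is 0 on cells where a vanishes. *)
Definition mean p (j : idx p) f : K :=
  intK (Mul (mcsgn a) (rs (cell j) f)) / ofR (rnorm (rs (cell j) a)).

(** If A had a kernel, this would be the operator whose kernel is the positive
   part of the average over each cell of the kernel of A. *)
Definition discr p f : L := \sum_(j : idx p) mean j f *: nu (cell j).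

Lemma discr_lin p (c : K) f g : discr p (c *: f + g) = c *: discr p f + discr p g.
Proof.
rewrite /discr scaler_sumr -big_split /=; apply: eq_bigr => j _.
rewrite scalerA -scalerDl; congr (_ *: _); rewrite /mean.
rewrite [rs _ _]linearP [Mul _ _]linearP [intK _]linearP.
by rewrite mulrDl -mulrA.
Qed.

Lemma discrB p f g : discr p (f - g) = discr p f - discr p g.
Proof.
by rewrite -(scaleN1r g) addrC discr_lin scaleN1r addrC.
Qed.

Lemma discr_le p f : rnorm (discr p f) <= rnorm f.
Proof.
rewrite (le_trans (rnorm_sum _ _ _))// (rnorm_cells p f).
apply: ler_sum => j _; rewrite rnormZ /mean absSM absSV absS_ofR.
rewrite ger0_norm ?rnorm_ge0//.
have [b0|b0] := eqVneq (rnorm (rs (cell j) a)) 0.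
  by rewrite b0 invr0 mulr0 mul0r rnorm_ge0.
rewrite -mulrA (le_trans (y := absS (intK (Mul (mcsgn a) (rs (cell j) f))) * 1))//.
  rewrite ler_wpM2l ?absS_ge0// mulrC ler_pdivrMr ?mul1r ?nu_le//.
  by rewrite lt_neqAle eq_sym b0 rnorm_ge0.
by rewrite mulr1 absS_intK_Mul.
Qed.

Lemma discr_supp p f : discr p (rs (supp a) f) = discr p f.
Proof.
by apply: eq_bigr => j _; rewrite /mean rsC Mul_csgn_supp.
Qed.

Lemma discr_step p (v : idx p -> K) :
  discr p (step v a) = \sum_j v j *: nu (cell j).
Proof.
apply: eq_bigr => j _; rewrite /mean rs_step.
rewrite [Mul _ _]linearZ [intK _]linearZ /= intK_csgn_rs.
have [b0|b0] := eqVneq (rnorm (rs (cell j) a)) 0.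
  have -> : nu (cell j) = 0.
    by rewrite /nu (rnorm_eq0 b0) linear0 posp0.
  by rewrite !scaler0.
rewrite -[X in (X / _) *: _]/(v j * ofR (rnorm (rs (cell j) a))) mulfK//.
by apply: contra_neq b0 => b0; rewrite -(reS_ofR (k := k) (rnorm _)) b0 reS0.
Qed.

Definition mass p : R := \sum_(j : idx p) rnorm (nu (cell j)).

(** By subadditivity the difference lies in the cone, where norms add up. *)
Lemma nu_refine p q (c : idx p -> idx q) j : refines c ->
  rnorm (\sum_(i | c i == j) nu (cell i) - nu (cell j)) =
    \sum_(i | c i == j) rnorm (nu (cell i)) - rnorm (nu (cell j)).
Proof.
move=> pq.
have E : cone G (\sum_(i | c i == j) nu (cell i) - nu (cell j)).
  by rewrite /nu (rs_cell_sum j a pq) linear_sum; exact: posp_sub.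
have [_] := coneD E (nu_cone (cell j)); rewrite subrK => e.
have [_ e'] := cone_sum (index_enum _) (fun i (_ : c i == j) => nu_cone (cell i)).
by rewrite -e' e addrK.
Qed.

Lemma mass_refine p q (c : idx p -> idx q) : refines c ->
  mass p - mass q = \sum_j rnorm (\sum_(i | c i == j) nu (cell i) - nu (cell j)).
Proof.
move=> pq; rewrite (eq_bigr _ (fun j _ => nu_refine j pq)) sumrB /mass.
by rewrite (partition_big c predT).
Qed.

Lemma discr_refine p q (c : idx p -> idx q) (v : idx q -> K) (M : R) :
    refines c -> (forall j, absS (v j) <= M) ->
  rnorm (discr p (step v a) - discr q (step v a)) <= M * (mass p - mass q).
Proof.
move=> pq vM; rewrite {1}(step_refine v a pq) !discr_step (mass_refine pq).
have -> : \sum_i (v \o c) i *: nu (cell i) - \sum_j v j *: nu (cell j) =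
    \sum_j v j *: (\sum_(i | c i == j) nu (cell i) - nu (cell j)).
  rewrite (partition_big c predT)//= -sumrB; apply: eq_bigr => j _.
  by rewrite scalerBr scaler_sumr; congr (_ - _); apply: eq_bigr => i /eqP ->.
rewrite (le_trans (rnorm_sum _ _ _))// mulr_sumr.
by apply: ler_sum => j _; rewrite rnormZ ler_wpM2r ?rnorm_ge0.
Qed.

(** The masses are bounded by the norm of a and increase under refinement. Past a
   partition almost realizing their supremum, discr_refine leaves no room for
   variation on a step function, and step functions are dense. *)
Lemma discr_cauchy f (e : R) : 0 < e ->
  exists p0, forall p, finer p p0 -> rnorm (discr p f - discr p0 f) <= e.
Proof.
move=> e0; have e3 : 0 < e / 3 by rewrite divr_gt0.
have [q [v hv]] := approx_supp (rs_id (supp a) f) e3.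
set M := \sum_j absS (v j).
have M0 : 0 <= M by rewrite sumr_ge0// => j _; exact: absS_ge0.
have vM j : absS (v j) <= M.
  by rewrite /M (bigD1 j)//= lerDl sumr_ge0// => i _; exact: absS_ge0.
have M1 : 0 < M + 1 by rewrite ltr_wpDl.
pose O := [set r | exists p : part T, r = mass p].
have supO : has_sup O.
  split; first by exists (mass trivial_part), trivial_part.
  exists (rnorm a) => _ [p ->].
  by rewrite (rnorm_cells p a); apply: ler_sum => j _; exact: nu_le.
have [_ [p1 ->] p1e] := sup_adherent (divr_gt0 e3 M1) supO.
have [c0 hc0] := common_l q p1; have [c1 hc1] := common_r q p1.
set p0 := common q p1 in c0 hc0 c1 hc1.
exists p0 => p [c hc]; pose s := step (v \o c0) a.
have sv : rnorm (rs (supp a) f - s) <= e / 3.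
  by rewrite /s -(step_refine v a hc0) ltW.
have h1 : rnorm (discr p s - discr p0 s) <= e / 3.
  have vM' (j : idx p0) : absS ((v \o c0) j) <= M by exact: vM.
  rewrite (le_trans (discr_refine hc vM'))//.
  have m1 : mass p <= sup O by apply: ub_le_sup; [exact: supO.2|by exists p].
  have m2 : mass p1 <= mass p0.
    by rewrite -subr_ge0 (mass_refine hc1) sumr_ge0// => j _; exact: rnorm_ge0.
  have m3 : mass p - mass p0 <= e / 3 / (M + 1) by lra.
  rewrite (le_trans (ler_wpM2l M0 m3))// mulrCA ler_piMr ?(ltW e3)//.
  by rewrite ler_pdivrMr// mul1r lerDl.
rewrite -(discr_supp p f) -(discr_supp p0 f).
have -> : discr p (rs (supp a) f) - discr p0 (rs (supp a) f) =
    discr p (rs (supp a) f - s) + (discr p s - discr p0 s) + discr p0 (s - rs (supp a) f).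
  have tel (x y z w : L) : x - w = (x - y) + (y - z) + (z - w).
    by rewrite (addrA (x - y)) subrK addrA subrK.
  by rewrite !discrB; exact: tel.
have d1 := discr_le p (rs (supp a) f - s); have d2 := discr_le p0 (s - rs (supp a) f).
move: d2; rewrite (rnormB s) => d2.
have := rnormD (discr p (rs (supp a) f - s) + (discr p s - discr p0 s)) (discr p0 (s - rs (supp a) f)).
have := rnormD (discr p (rs (supp a) f - s)) (discr p s - discr p0 s).
lra.
Qed.

(** The limit of the discretizations. Positivity relatively to G and closeness
   to A hold cell by cell for the discretizations, and pass to the limit. *)
Theorem positive_part_operator (kap : R) : 0 <= kap ->
    (forall B, rnorm (A (rs B a) - nu B) <= kap * rnorm (rs B a)) ->
  exists Q : {linear L -> L},
    [/\ forall f, rnorm (Q f) <= rnorm f,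
        forall f, Q (rs (supp a) f) = Q f,
        forall B, cone G (Q (rs B a)) &
        forall B, rnorm (A (rs B a) - Q (rs B a)) <= kap * rnorm (rs B a)].
Proof.
move=> kap0 hnu.
have lim f : {l : L | forall e : R, 0 < e ->
    exists p0, forall p, finer p p0 -> rnorm (discr p f - l) <= e}.
  by apply: cid; apply: complete_net; exact: discr_cauchy.
pose q f := sval (lim f).
have qP f e : 0 < e -> exists p0, forall p, finer p p0 -> rnorm (discr p f - q f) <= e.
  exact: (svalP (lim f)).
have qlin c f g : q (c *: f + g) = c *: q f + q g.
  apply/eqP; rewrite -subr_eq0; apply/eqP; apply: rnorm_small => e e0.
  have c1 : 0 < absS c + 2 by rewrite ltr_wpDl// absS_ge0.
  have e1 := divr_gt0 e0 c1.
  have [p1 h1] := qP (c *: f + g) _ e1.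
  have [p2 h2] := qP f _ e1; have [p3 h3] := qP g _ e1.
  pose p := common p1 (common p2 p3).
  have f1 : finer p p1 by exact: common_l.
  have f2 : finer p p2 by apply: finer_trans (common_l p2 p3); exact: common_r.
  have f3 : finer p p3 by apply: finer_trans (common_r p2 p3); exact: common_r.
  have -> : q (c *: f + g) - (c *: q f + q g) =
      - (discr p (c *: f + g) - q (c *: f + g)) + c *: (discr p f - q f) + (discr p g - q g).
    have alg (x y z t w : L) : z - (t + w) = - (x + y - z) + (x - t) + (y - w).
      by rewrite opprB -addrA (addrACA x) -opprD (addrA (z - _)) subrK.
    by rewrite discr_lin scalerBr; exact: alg.
  have -> : e = e / (absS c + 2) + absS c * (e / (absS c + 2)) + e / (absS c + 2).
    by field; rewrite gt_eqF.
  apply: (le_trans (rnormD _ _)); apply: lerD; last exact: (h3 _ f3).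
  apply: (le_trans (rnormD _ _)); apply: lerD.
    by rewrite rnormN; exact: (h1 _ f1).
  by rewrite rnormZ; apply: ler_wpM2l; [exact: absS_ge0|exact: (h2 _ f2)].
have [Q QE] := lin_map_exists qlin.
have Qlim f (q0 : part T) e : 0 < e ->
    exists p c, @refines _ _ p q0 c /\ rnorm (discr p f - Q f) <= e.
  move=> e0; have [p1 h1] := qP f e e0.
  have [c hc] := common_r p1 q0.
  by exists (common p1 q0), c; split => //; rewrite QE; apply: h1; exact: common_l.
have stepB B : exists q0 : part T, exists v : idx q0 -> R,
    (forall j, 0 <= v j) /\ rs B a = step (fun j => ofR (v j)) a.
  have m b : measurable_fun [set: T] (fun x => B x == b).
    case: b; first by under eq_fun do rewrite eqb_id; exact: bsetM.
    by under eq_fun do rewrite eqbF_neg; exact: measurable_neg (bsetM B).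
  exists (Part m), (fun b : bool => b%:R); split => //.
  rewrite /step big_bool /= ofR1 ofR0 scale1r scale0r addr0.
  by apply: eq_rs => x /=; rewrite eqb_id.
exists Q; split.
- move=> f; apply/ler_addgt0Pl => e e0.
  have [p [c [_ h]]] := Qlim f trivial_part e e0.
  rewrite -(subrK (discr p f) (Q f)) (le_trans (rnormD _ _))//.
  apply: lerD; last exact: discr_le.
  by rewrite rnormB.
- move=> f; apply/eqP; rewrite -subr_eq0; apply/eqP; apply: rnorm_small => e e0.
  have e2 : 0 < e / 2 by rewrite divr_gt0.
  have [p1 h1] := qP (rs (supp a) f) _ e2; have [p2 h2] := qP f _ e2.
  have := h1 _ (common_l p1 p2); have := h2 _ (common_r p1 p2).
  rewrite discr_supp -!QE rnormB => t1; rewrite rnormB => t2.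
  set D := discr _ _ in t1 t2.
  rewrite -(subrK D (Q (rs _ f))) -addrA (le_trans (rnormD _ _))//.
  by rewrite (splitr e) lerD// rnormB.
- move=> B; apply: cone_lim => e e0.
  have [q0 [v [v0 Bv]]] := stepB B.
  have [p [c [hc h]]] := Qlim (rs B a) q0 e e0.
  exists (discr p (rs B a)) => //.
  rewrite Bv (step_refine _ _ hc) discr_step.
  by apply: (cone_sum _ _).1 => i _; apply: coneZ => //; exact: nu_cone.
- move=> B; apply/ler_addgt0Pl => e e0.
  have [q0 [v [v0 Bv]]] := stepB B.
  have [p [c [hc h]]] := Qlim (rs B a) q0 e e0.
  rewrite -(subrK (discr p (rs B a)) (A (rs B a))) -addrA (le_trans (rnormD _ _))//.
  rewrite [leRHS]addrC; apply: lerD => //.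
  rewrite Bv (step_refine _ _ hc) discr_step rnorm_step mulr_sumr.
  rewrite /step linear_sum -sumrB (le_trans (rnorm_sum _ _ _))//.
  apply: ler_sum => i _; rewrite linearZ -scalerBr rnormZ mulrCA.
  by rewrite ler_wpM2l ?absS_ge0.
Qed.

End PositiveOperator.

(** * The perturbation *)

Section Perturbation.
Context {R : realType} {k : scalar_kind} {d : measure_display}
  {T : measurableType d} {mu : {measure set T -> \bar R}}.
Local Notation K := (scalar_field R k).
Local Notation L := (L1 k mu).
Implicit Types (f g h : L) (A B D : mset T).

Lemma rs_disj A B f : (forall x, ~~ (A x && B x)) -> rs A (rs B f) = 0.
Proof.
move=> AB; apply: L1_ext.
apply: filterS3 (fn_rs A (rs B f)) (fn_rs B f) (@fn0 R k d T mu) => x -> -> ->.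
by rewrite mulrA -natrM mulnb (negbTE (AB x)) mul0r.
Qed.

(** A restriction of f contributing less than its norm could not be compensated
   by the complementary one. *)
Lemma norming_rs (F : {linear L -> K^o}) f : (forall h, absS (F h) <= rnorm h) ->
  F f = ofR (rnorm f) -> forall B, F (rs B f) = ofR (rnorm (rs B f)).
Proof.
move=> F1 Ff B; apply: absS_le_reS; first exact: F1.
have := rnorm_splits B f; have := F1 (rs (msC B) f).
have := reS_le (F (rs (msC B) f)).
have : reS (F (rs B f)) + reS (F (rs (msC B) f)) = rnorm f.
  by rewrite -reSD -linearD -rs_splits Ff reS_ofR.
set x := reS _; set y := reS _; set z := absS _; lra.
Qed.

(** Markov's inequality for the defect of F from norming f: the set where the
   relative defect is at most dl comes from a Hahn decomposition. *)
Lemma markov_hahn (F : {linear L -> K^o}) f (dl eta : R) :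
    (forall h, absS (F h) <= rnorm h) -> rnorm f - eta <= reS (F f) ->
  exists D, (forall B, msub B D -> (1 - dl) * rnorm (rs B f) <= reS (F (rs B f))) /\
    dl * rnorm (rs (msC D) f) <= eta.
Proof.
move=> F1 Ff.
have [H HE] : {H : {linear L -> K^o} | forall h,
    H h = F h - ofR (1 - dl) * intK (Mul (mcsgn f) h)}.
  apply: lin_map_exists => a x y.
  rewrite linearP [Mul _ _]linearP [intK _]linearP /=.
  move: (F x) (F y) (intK _) (intK _) (ofR _) => p q s r c.
  by change (a * p + q - c * (a * r + s) = a * (p - c * r) + (q - c * s) :> K); ring.
have Hb h : absS (H h) <= (1 + `|1 - dl|) * rnorm h.
  rewrite HE (le_trans (ler_absSD _ _))// absSN absSM absS_ofR mulrDl mul1r.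
  by rewrite lerD// ler_wpM2l// absS_intK_Mul.
have Hre B : reS (H (rs B f)) = reS (F (rs B f)) - (1 - dl) * rnorm (rs B f).
  by rewrite HE intK_csgn_rs reSB reSZ reS_ofR.
have [D [Dp Dn]] := hahn f (addr_ge0 ler01 (normr_ge0 (1 - dl))) Hb.
exists D; split; first by move=> B /Dp; rewrite Hre subr_ge0.
have := Dn (msC D) (fun x => id); rewrite Hre.
have := rnorm_splits D f; have := le_trans (reS_le _) (F1 (rs D f)).
have : reS (F f) = reS (F (rs D f)) + reS (F (rs (msC D) f)).
  by rewrite -reSD -linearD -rs_splits.
move: Ff; set a := reS _; set b := reS _; set c := reS _.
set x := rnorm _; set y := rnorm _; set z := rnorm _; nra.
Qed.

(** Expanding the square of the modulus of z - b gives at most 2 b (b - re z). *)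
Lemma near_real (z : K) (b kap : R) : 0 <= b -> 0 <= kap -> absS z <= b ->
  (1 - kap ^+ 2 / 2) * b <= reS z -> absS (z - ofR b) <= kap * b.
Proof.
move=> b0 k0 zb rz; rewrite -(@ler_pXn2r _ 2) ?nnegrE ?absS_ge0 ?mulr_ge0//.
rewrite absS_sqr reSB imSB reS_ofR imS_ofR subr0.
have := absS_sqr z; have := absS_ge0 z; move: zb rz.
set s := absS z; set x := reS z; set y := imS z => zb rz s0 E.
have : s ^+ 2 <= b ^+ 2 by rewrite ler_pXn2r// nnegrE.
nra.
Qed.

(** On the support of f0, G is the conjugate sign of f0, which already represents
   g0 there. Off this support, on the part r' of r which g0 almost norms, it is the
   conjugate sign of r, close to g0 by close_csgn. On the remaining set E, G vanishes and g1 is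
   g0. *)
Lemma perturb_functional (g0 : {linear L -> K^o}) f0 r (kap eta : R) :
    0 < kap -> (forall h, absS (g0 h) <= rnorm h) ->
    g0 f0 = ofR (rnorm f0) -> rnorm r - eta <= reS (g0 r) ->
  exists (G : @mult R k d T) (g1 : {linear L -> K^o}),
    [/\ forall x, G x = 0 \/ absS (G x) = 1,
        (forall h, absS (g1 h) <= rnorm h) /\
        (forall h, absS (g0 h - g1 h) <= kap * rnorm h),
        forall h, cone G h -> g1 h = ofR (rnorm h),
        forall B, cone G (rs B f0) &
        reS (g0 r) - eta / (kap ^+ 2 / 2) <= reS (intK (Mul G r))].
Proof.
move=> kap0 g01 gf0 gr.
set d1 := kap ^+ 2 / 2; have d10 : 0 < d1 by rewrite divr_gt0// exprn_gt0.
have [D [Dp Dn]] := markov_hahn d1 g01 gr.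
pose P0 := supp f0; pose r' := rs D (rs (msC P0) r).
pose W := msI (msC P0) (supp r'); pose E := msI (msC P0) (msC (supp r')).
pose G := mif P0 (mcsgn f0) (mcsgn r').
have GE h : Mul G h = Mul (mcsgn f0) (rs P0 h) + Mul (mcsgn r') (rs W h).
  apply: L1_ext; apply: filterS3 (filterI (fnMul G h) (fnD (Mul (mcsgn f0) (rs P0 h)) (Mul (mcsgn r') (rs W h))))
    (filterI (fnMul (mcsgn f0) (rs P0 h)) (fn_rs P0 h))
    (filterI (fnMul (mcsgn r') (rs W h)) (fn_rs W h)) => x [-> ->] [-> ->] [-> ->].
  rewrite /G /=; have [f00|f00] := eqVneq (fn f0 x) 0 => /=.
    rewrite mul0r mulr0 add0r; have [r0|r0] := eqVneq (fn r' x) 0 => /=.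
      by rewrite /csgn r0 normr0 !mul0r.
    by rewrite mul1r.
  by rewrite mul1r mul0r mulr0 addr0.
have splitE h : rs (msC E) h = rs P0 h + rs W h.
  apply: L1_ext; apply: filterS3 (fn_rs (msC E) h) (filterI (fn_rs P0 h) (fn_rs W h)) (fnD (rs P0 h) (rs W h)).
  move=> x -> [e1 e2] ->; rewrite e1 e2 -mulrDl; congr (_ * _) => /=.
  by case: (fn f0 x == 0); case: (fn r' x == 0) => /=; rewrite ?addr0 ?add0r.
have g0f0 B : g0 (rs B f0) = ofR (rnorm (rs B f0)) by exact: norming_rs.
(* here close_csgn applies with the bound 0, which gives an equality *)
have g0P h : g0 (rs P0 h) = intK (Mul (mcsgn f0) (rs P0 h)).
  have g0b h' : absS (g0 h') <= 1 * rnorm h' by rewrite mul1r.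
  have z B : absS (g0 (rs B f0) - ofR (rnorm (rs B f0))) <= 0 * rnorm (rs B f0).
    by rewrite g0f0 subrr absS0 mul0r.
  have := close_csgn ler01 (lexx 0) g0b z (rs_id P0 h).
  rewrite mul0r le_eqVlt ltNge absS_ge0 orbF => /eqP/absS_eq0/eqP.
  by rewrite subr_eq0 => /eqP.
have g0W h : absS (g0 (rs W h) - intK (Mul (mcsgn r') (rs W h))) <= kap * rnorm (rs W h).
  have g0b h' : absS (g0 h') <= 1 * rnorm h' by rewrite mul1r.
  apply: (close_csgn ler01 (ltW kap0) g0b) => [B|].
    apply: near_real; rewrite ?rnorm_ge0 ?(ltW kap0)//.
    by rewrite /r' !rs_rs; apply: Dp => x; rewrite /= => /andP[/andP[]].
  by rewrite rs_rs; apply: eq_rs => x /=; rewrite andbCA andbb.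
have GI h : intK (Mul G h) = g0 (rs P0 h) + intK (Mul (mcsgn r') (rs W h)).
  by rewrite GE linearD g0P.
have [g1 g1E] : {g1 : {linear L -> K^o} | forall h, g1 h = intK (Mul G h) + g0 (rs E h)}.
  apply: lin_map_exists => a x y.
  by rewrite [Mul _ _]linearP [intK _]linearP [rs _ _]linearP [g0 _]linearP scalerDr addrACA.
have GEn h : absS (intK (Mul G h)) <= rnorm (rs (msC E) h).
  have -> : Mul G h = Mul G (rs (msC E) h).
    rewrite GE splitE [in RHS]GE; congr (Mul _ _ + Mul _ _).
      rewrite -splitE rs_rs; apply: eq_rs => x /=.
      by case: (fn f0 x == 0).
    rewrite -splitE rs_rs; apply: eq_rs => x /=.
    by case: (fn f0 x == 0); case: (fn r' x == 0).
  exact: absS_intK_Mul.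
exists G, g1; split.
- move=> x; rewrite /G /=; case: (fn f0 x =P 0) => /= [_|/eqP f00]; last first.
    by right; rewrite absS_csgn f00.
  have [->|r0] := eqVneq (fn r' x) 0; first by left; rewrite /csgn normr0 mul0r.
  by right; rewrite absS_csgn r0.
- split=> h.
    rewrite g1E (le_trans (ler_absSD _ _))// (rnorm_splits E h) [leRHS]addrC.
    by apply: lerD; [exact: GEn|exact: g01].
  have e2 : g0 h = g0 (rs E h) + (g0 (rs P0 h) + g0 (rs W h)).
    by rewrite {1}(rs_splits E h) linearD splitE linearD.
  rewrite g1E GI e2; have := g0W h.
  set u := g0 (rs E h); set v := g0 (rs P0 h); set w := g0 (rs W h); set z := intK _.
  have alg (V : zmodType) (x y x' y' : V) : x + (y + x') - (y + y' + x) = x' - y'.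
    by rewrite (addrC (y + y') x) opprD addrACA subrr add0r opprD addrACA subrr add0r.
  rewrite alg => wz.
  rewrite (le_trans wz)// ler_wpM2l ?(ltW kap0)//; exact: rnorm_rs.
- move=> h ch; rewrite g1E; have := GEn h; rewrite ch absS_ofR ger0_norm ?rnorm_ge0//.
  rewrite {1}(rnorm_splits E h) gerDr => n0.
  have -> : rs E h = 0 by apply: rnorm_eq0; apply/eqP; rewrite eq_le n0 rnorm_ge0.
  by rewrite linear0 addr0.
- move=> B; rewrite /cone GI [rs P0 _]rsC rs_supp g0f0.
  have -> : rs W (rs B f0) = 0.
    rewrite -[in LHS](rs_supp f0) (rsC B) rs_disj// => x.
    by rewrite /W /P0 /=; case: (fn f0 x == 0); case: (fn r' x == 0).
  by rewrite [Mul _ 0]linear0 [intK 0]linear0 addr0.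
have WE : rs W r = r'.
  apply: L1_ext; apply: filterS3 (fn_rs W r) (fn_rs D (rs (msC P0) r)) (fn_rs (msC P0) r).
  move=> x -> + e2; rewrite e2 -/r' => e1.
  have [r0|r0] := eqVneq (fn r' x) 0; first by rewrite /= r0 eqxx andbF mul0r.
  move: (r0); rewrite {1}e1 /= r0 andbT.
  case: (D x) e1; last by rewrite !mul0r eqxx.
  by case: (~~ _) => ->; rewrite ?mul1r// !mul0r mulr0 eqxx.
rewrite GI WE intK_csgn.
have e2 : g0 r = g0 (rs P0 r) + (g0 r' + g0 (rs (msC D) (rs (msC P0) r))).
  by rewrite -linearD -(rs_splits D) -linearD -rs_splits.
rewrite e2 !reSD reS_ofR.
have := le_trans (reS_le _) (g01 r').
have := le_trans (reS_le _) (g01 (rs (msC D) (rs (msC P0) r))).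
have : rnorm (rs (msC D) (rs (msC P0) r)) <= eta / d1.
  by rewrite rsC (le_trans (rnorm_rs _ _))// ler_pdivlMr// mulrC.
set x1 := reS _; set x2 := reS _; set x3 := reS _; set x4 := rnorm _; set x5 := rnorm _.
set x6 := eta / d1.
lra.
Qed.

End Perturbation.

Section Contraction.
Context {R : realType} {k : scalar_kind} {d : measure_display}
  {T : measurableType d} {mu : {measure set T -> \bar R}}.
Local Notation K := (scalar_field R k).
Local Notation L := (L1 k mu).
Implicit Types (f g h : L) (A B D : mset T).


(** The constants: d1 bounds the relative defect in the choice of g1, at distance
   at most e / 2 of g0; t ^+ 2 bounds the relative defect of A on a, so that A is
   at distance 3 t / 2 of its positive part by posp_close; the loss of mass, to be
   restored by the operator of rank 1, is then at most 3 t / 2 + t ^+ 2, and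
   t = e / 8 makes the sum of these distances at most e / 2. *)
Lemma perturb_contraction (A : {linear L -> L}) (g0 : {linear L -> K^o}) f0 (e : R) :
    0 < e <= 1 ->
    (forall f, rnorm (A f) <= rnorm f) -> (forall h, absS (g0 h) <= rnorm h) ->
    rnorm f0 = 1 -> g0 f0 = 1 ->
    1 - e / 4 * (e / 8) ^+ 2 / (1 + ((e / 2) ^+ 2 / 2)^-1) < reS (g0 (A f0)) ->
  exists (A1 : {linear L -> L}) (f1 : L) (g1 : {linear L -> K^o}),
    [/\ forall f, rnorm (A1 f) <= rnorm f,
        numstate f1 g1 & g1 (A1 f1) = 1] /\
    [/\ rnorm (f0 - f1) <= e / 2,
        forall h, absS (g0 h - g1 h) <= e / 2 * rnorm h &
        forall f, rnorm (A1 f - A f) <= e / 2 * rnorm f].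
Proof.
move=> /andP[e0 e1] A1 g01 f01 gf0; set d1 := (e / 2) ^+ 2 / 2.
set eta := e / 4 * (e / 8) ^+ 2 / (1 + d1^-1) => gA.
have d10 : 0 < d1 by rewrite divr_gt0// exprn_gt0// divr_gt0.
have eta0 : 0 < eta.
  apply: divr_gt0; last by rewrite addr_gt0// invr_gt0.
  by apply: mulr_gt0; [exact: divr_gt0|rewrite exprn_gt0// divr_gt0].
have etaE : eta + eta / d1 = e / 4 * (e / 8) ^+ 2.
  by rewrite -[X in X + _]mulr1 -mulrDr /eta divfK// gt_eqF// addr_gt0// invr_gt0.
have e20 : 0 < e / 2 by rewrite divr_gt0.
pose t := e / 8; have t0 : 0 < t by rewrite divr_gt0.
have gf0' : g0 f0 = ofR (rnorm f0) by rewrite gf0 f01 ofR1.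
have gr : rnorm (A f0) - eta <= reS (g0 (A f0)).
  by rewrite (le_trans _ (ltW gA))// lerD2r (le_trans (A1 _))// f01.
have [G [g1 [Gu [g11 g1g] g1c cf GA]]] := perturb_functional e20 g01 gf0' gr.
pose F : {linear L -> K^o} := intK \o (Mul G \o A).
have F1 h : absS (F h) <= rnorm h by rewrite (le_trans (absS_intK_Mul _ _)).
have F0 : rnorm f0 - e / 4 * (e / 8) ^+ 2 <= reS (F f0).
  by rewrite (le_trans _ GA)// f01 -etaE -/d1 opprD addrA lerD2r ltW.
have [D [Dp Dn]] := markov_hahn (t ^+ 2) F1 F0.
pose a := rs D f0.
have Da : rnorm (rs (msC D) f0) <= e / 4.
  by move: Dn; rewrite mulrC ler_pM2r// exprn_gt0.
have := rnorm_splits D f0; rewrite f01 -/a => al.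
have al0 : 0 < rnorm a by lra.
have aV0 : 0 <= (rnorm a)^-1 by rewrite invr_ge0 ltW.
have ca B : cone G (rs B a) by rewrite /a rs_rs; exact: cf.
have ca' : cone G a by exact: cf.
pose f1 : L := ofR (rnorm a)^-1 *: a.
have nf1 : rnorm f1 = 1.
  by rewrite rnormZ absS_ofR ger0_norm// mulVf// gt_eqF.
have cf1 : cone G f1 by exact: coneZ.
have sg1 : numstate f1 g1 by apply: numstate_intro; rewrite ?g1c ?nf1 ?ofR1.
have AB B : (1 - t ^+ 2) * rnorm (rs B a) <= reS (intK (Mul G (A (rs B a)))).
  by rewrite /a rs_rs; apply: Dp => x /= /andP[].
have nuB B : rnorm (A (rs B a) - nu G A a B) <= 3 / 2 * t * rnorm (rs B a).
  rewrite /nu (le_trans (posp_close Gu _ t0))//.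
  have := AB B; have := A1 (rs B a).
  set x := rnorm _; set y := rnorm _; set z := reS _ => xy yz.
  have : (x - z) / (2 * t) <= t ^+ 2 * y / (2 * t).
    by rewrite ler_wpM2r ?invr_ge0 ?mulr_ge0 ?(ltW t0)//; lra.
  have -> : t ^+ 2 * y / (2 * t) = t * y / 2 by field; rewrite gt_eqF.
  have := ler_wpM2l (ltW t0) xy; lra.
have k0 : 0 <= 3 / 2 * t by rewrite mulr_ge0 ?(ltW t0)// divr_ge0.
have [Q [Q1 Qs Qc QA]] := positive_part_operator Gu A1 k0 nuB.
(* the defect of Q is compensated by an operator of rank one *)
have [Dl DlE] : {Dl : {linear L -> K^o} | forall f,
    Dl f = intK (Mul (mcsgn a) f) - intK (Mul G (Q f))}.
  apply: lin_map_exists => c x y.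
  rewrite [Mul _ _]linearP [intK _]linearP [Q _]linearP [Mul G _]linearP [intK (_ + _)]linearP /=.
  by rewrite scalerBr opprD addrACA.
have [P PE] : {P : {linear L -> L} | forall f, P f = Q f + Dl f *: f1}.
  apply: lin_map_exists => c x y.
  by rewrite [Q _]linearP [Dl _]linearP scalerDl -scalerA scalerDr addrACA.
have Dl2 h : absS (Dl h) <= 2 * rnorm h.
  rewrite DlE (le_trans (ler_absSD _ _))// absSN mulrDl mul1r.
  by rewrite lerD ?absS_intK_Mul// (le_trans (absS_intK_Mul _ _)).
have Ps f : P (rs (supp a) f) = P f by rewrite !PE !DlE Qs Mul_csgn_supp.
have DlB B : Dl (rs B a) = ofR (rnorm (rs B a) - rnorm (Q (rs B a))).
  by rewrite DlE intK_csgn_rs Qc ofRD ofRN.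
have dB B : 0 <= rnorm (rs B a) - rnorm (Q (rs B a)) by rewrite subr_ge0.
have dB' B : rnorm (rs B a) - rnorm (Q (rs B a)) <=
    (3 / 2 * t + t ^+ 2) * rnorm (rs B a).
  have : reS (intK (Mul G (A (rs B a)))) - rnorm (Q (rs B a)) <=
      rnorm (A (rs B a) - Q (rs B a)).
    rewrite -[X in _ - X](reS_ofR (k := k)) -(Qc B) -reSB -linearB -linearB.
    by rewrite (le_trans (reS_le _))// absS_intK_Mul.
  have := QA B; have := AB B.
  set x := rnorm _; set y := rnorm _; set z := rnorm _; set w := reS _.
  lra.
have PB B : cone G (P (rs B a)) /\ rnorm (P (rs B a)) = rnorm (rs B a).
  rewrite PE DlB; have [c1 ->] := coneD (Qc B) (coneZ (dB B) cf1).
  split => //; rewrite rnormZ nf1 mulr1 absS_ofR ger0_norm//.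
  by rewrite addrC subrK.
have P3 h : rnorm (P h) <= 3 * rnorm h.
  rewrite PE (le_trans (rnormD _ _))// rnormZ nf1 mulr1.
  by have := Q1 h; have := Dl2 h; set x := rnorm h; set y := rnorm _; set z := absS _; lra.
have P1 f : rnorm (P f) <= rnorm (rs (supp a) f).
  rewrite -Ps -[leRHS]mul1r; apply: (@dense_bound _ _ _ _ _ _ P 1 3 a) (rs_id _ _) => //.
  by move=> B; rewrite (PB B).2 mul1r.
have [H HE] : {H : {linear L -> L} | forall f, H f = P f - A f}.
  by apply: lin_map_exists => c x y; rewrite [P _]linearP [A _]linearP scalerBr opprD addrACA.
have H1 f : rnorm (H (rs (supp a) f)) <= e / 2 * rnorm (rs (supp a) f).
  apply: (@dense_bound _ _ _ _ _ _ H (e / 2) 4 a) (rs_id _ _) => //; last 2 first.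
  - exact: ltW.
  - move=> B; rewrite HE PE DlB.
    rewrite -addrA addrCA (le_trans (rnormD _ _))// rnormZ nf1 mulr1 absS_ofR ger0_norm//.
    have := dB' B; have := QA B; rewrite rnormB; have := rnorm_ge0 (rs B a).
    set x := rnorm (rs B a); set y := rnorm _; set z := rnorm _ => x0 h1 h2.
    have : 3 * t + t ^+ 2 <= e / 2 by rewrite /t; nra.
    move=> /(ler_wpM2r x0); lra.
  move=> h; rewrite HE (le_trans (rnormD _ _))// rnormN.
  by have := P3 h; have := A1 h; set x := rnorm _; set y := rnorm _; set z := rnorm _; lra.
have [B1 BE] : {B1 : {linear L -> L} | forall f, B1 f = A (rs (msC (supp a)) f) + P f}.
  apply: lin_map_exists => c x y.
  by rewrite [rs _ _]linearP [A _]linearP [P _]linearP scalerDr addrACA.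
exists B1, f1, g1; split; split => //.
- move=> f; rewrite BE (le_trans (rnormD _ _))// (rnorm_splits (supp a) f) addrC.
  by rewrite lerD.
- have -> : B1 f1 = P f1.
    have Sa : rs (msC (supp a)) (rs (supp a) a) = 0.
      by apply: rs_disj => x; rewrite /= andNb.
    rewrite rs_supp in Sa.
    by rewrite BE {1}/f1 [rs _ _]linearZ /= Sa scaler0 linear0 add0r.
  have aD : a = rs D a by rewrite /a rs_id.
  have [cP nP] := PB D; rewrite -aD in cP nP.
  rewrite g1c /f1 linearZ; last exact: coneZ.
  by rewrite rnormZ absS_ofR ger0_norm// nP mulVf ?ofR1// gt_eqF.
- have -> : f0 - f1 = rs (msC D) f0 + (1 - ofR (rnorm a)^-1) *: a.
    by rewrite {1}(rs_splits D f0) -/a scalerBl scale1r addrAC addrC.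
  rewrite (le_trans (rnormD _ _))// rnormZ.
  have -> : absS (1 - ofR (rnorm a)^-1 : K) * rnorm a = 1 - rnorm a.
    rewrite -ofR1 -ofRN -ofRD absS_ofR distrC ger0_norm.
      by rewrite mulrBl mul1r mulVf// gt_eqF.
    rewrite subr_ge0 -[leLHS]invr1 lef_pV2 ?posrE// al lerDl.
    exact: rnorm_ge0.
  by move: Da al; set x := rnorm _; set y := rnorm _; lra.
- move=> f; have -> : B1 f - A f = H (rs (supp a) f).
    have -> : A f = A (rs (msC (supp a)) f) + A (rs (supp a) f).
      by rewrite addrC -linearD -rs_splits.
    by rewrite BE HE Ps opprD addrACA subrr add0r.
  by rewrite (le_trans (H1 f))// ler_wpM2l ?(ltW e20)// rnorm_rs.
Qed.

End Contraction.

(** * The theorem *)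

Section Main.
Context {R : realType} {k : scalar_kind}.
Local Notation K := (scalar_field R k).

(** Rotating A by the conjugate sign of g0 (A f0) makes this number positive; the
   perturbed operator is rotated back. *)
Lemma bpb_exists (eps : R) : 0 < eps ->
  exists2 eta : R, 0 < eta &
  forall (d : measure_display) (T : measurableType d)
    (mu : {measure set T -> \bar R}) (A : {linear L1 k mu -> L1 k mu})
    (f0 : L1 k mu) (g0 : {linear L1 k mu -> K^o}),
    continuous A -> numradius A = 1 -> numstate f0 g0 ->
    absS (g0 (A f0)) > 1 - eta ->
  exists (A1 : {linear L1 k mu -> L1 k mu}) (f1 : L1 k mu)
    (g1 : {linear L1 k mu -> K^o}),
    [/\ continuous A1, numstate f1 g1, numradius A1 = 1 & absS (g1 (A1 f1)) = 1] /\
    exists2 c, 0 <= c < eps &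
      [/\ rnorm (f0 - f1) <= c, forall h, absS (g0 h - g1 h) <= c * rnorm h &
          forall f, rnorm (A1 f - A f) <= c * rnorm f].
Proof.
move=> eps0; pose e := Num.min eps 1.
have e0 : 0 < e by rewrite lt_min eps0 ltr01.
have e1 : e <= 1 by rewrite ge_min lexx orbT.
have ee : e <= eps by rewrite ge_min lexx.
have ceps : 0 <= e / 2 < eps.
  rewrite divr_ge0 ?(ltW e0)//= (lt_le_trans _ ee)//.
  by rewrite ltr_pdivrMr// ltr_pMr// ltr1n.
pose s := 1 + ((e / 2) ^+ 2 / 2)^-1.
have s1 : 1 <= s by rewrite lerDl invr_ge0 divr_ge0// exprn_ge0// divr_ge0// ltW.
have s0 : 0 < s by exact: lt_le_trans s1.
pose eta := e / 4 * (e / 8) ^+ 2 / s.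
have eta0 : 0 < eta.
  apply: divr_gt0 => //; apply: mulr_gt0; first exact: divr_gt0.
  by rewrite exprn_gt0// divr_gt0.
have eta1 : eta < 1.
  rewrite /eta ltr_pdivrMr// mul1r; apply: lt_le_trans s1.
  have : (e / 8) ^+ 2 <= 1 by rewrite exprn_ile1 ?divr_ge0 ?(ltW e0)//; lra.
  have : 0 <= (e / 8) ^+ 2 by rewrite sqr_ge0.
  nra.
exists eta => // d T mu A f0 g0 cA nA st gA.
have A1 f : rnorm (A f) <= rnorm f.
  by have := rnorm_numradius f cA; rewrite nA mul1r.
have [f01 _ _ gf0] := st.
set z := g0 (A f0) in gA; pose om := csgn z.
have z0 : z != 0.
  by apply/eqP => z0; move: gA; rewrite z0 absS0 ltNge subr_ge0 ltW.
have om1 : absS om = 1 by rewrite absS_csgn z0.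
have om0 : om != 0 by exact: absS1_neq0.
have [A' AE'] : {A' : {linear L1 k mu -> L1 k mu} | forall f, A' f = om *: A f}.
  by apply: lin_map_exists => c x y; rewrite linearP scalerDr !scalerA mulrC.
have A'1 f : rnorm (A' f) <= rnorm f by rewrite AE' rnormZ om1 mul1r.
have gA' : 1 - eta < reS (g0 (A' f0)).
  have -> : g0 (A' f0) = om * z by rewrite AE'; exact: linearZ.
  by rewrite csgnM reS_ofR.
have e01 : 0 < e <= 1 by rewrite e0.
have [B [f1 [g1 [[B1 st1 gB] [n1 n2 n3]]]]] :=
  perturb_contraction e01 A'1 (fun h => numstate_bound h st) f01 gf0 gA'.
have [C CE] : {C : {linear L1 k mu -> L1 k mu} | forall f, C f = om^-1 *: B f}.
  by apply: lin_map_exists => c x y; rewrite linearP scalerDr !scalerA mulrC.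
have C1 f : rnorm (C f) <= 1 * rnorm f.
  by rewrite CE rnormZ absSV om1 invr1 !mul1r.
have gC : absS (g1 (C f1)) = 1.
  have -> : g1 (C f1) = om^-1 * g1 (B f1) by rewrite CE; exact: linearZ.
  by rewrite gB mulr1 absSV om1 invr1.
exists C, f1, g1; split.
  split=> //; first exact: bounded_continuous C1.
  exact: numradius_eq C1 st1 gC.
exists (e / 2) => //.
split=> // f.
have -> : C f - A f = om^-1 *: (B f - A' f).
  by rewrite CE AE' scalerBr scalerA mulVf// scale1r.
by rewrite rnormZ absSV om1 invr1 mul1r.
Qed.

End Main.

Theorem theorem4p1 (R : realType) (k : scalar_kind) :
  (forall (d : measure_display) (T : measurableType d)
     (mu : {measure set T -> \bar R}), BPBp_nu (L1 k mu)) /\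
  (forall eps : R, 0 < eps ->
   exists2 eta : R, 0 < eta &
   forall (d : measure_display) (T : measurableType d)
     (mu : {measure set T -> \bar R})
     (T0 : {linear L1 k mu -> L1 k mu}) (f0 : L1 k mu)
     (g0 : {linear L1 k mu -> (scalar_field R k)^o}),
     continuous T0 -> numradius T0 = 1 -> numstate f0 g0 ->
     absS (g0 (T0 f0)) > 1 - eta ->
     exists (T1 : {linear L1 k mu -> L1 k mu}) (f1 : L1 k mu)
       (g1 : {linear L1 k mu -> (scalar_field R k)^o}),
       [/\ continuous T1, numstate f1 g1 &
           absS (g1 (T1 f1)) = numradius T1 /\ numradius T1 = 1] /\
       [/\ rnorm (f0 - f1) < eps, opnorm (g0 \- g1) < eps &
           opnorm (T1 \- T0) < eps]).
Proof.
split=> [d T mu eps /andP[eps0 _]|eps eps0].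
  have [eta eta0 h] := @bpb_exists R k eps eps0.
  exists eta => // A x phi cA st nA gA.
  have [B [y [psi [[cB sB nB gB] [c /andP[c0 ce] [n1 n2 n3]]]]]] := h _ _ _ _ _ _ cA nA st gA.
  exists B, y, psi; split; first by rewrite nB gB.
  split; [|exact: le_lt_trans ce|]; apply: le_lt_trans ce; apply: opnorm_le => // z.
  by rewrite rnormB.
have [eta eta0 h] := @bpb_exists R k eps eps0.
exists eta => // d T mu A x phi cA nA st gA.
have [B [y [psi [[cB sB nB gB] [c /andP[c0 ce] [n1 n2 n3]]]]]] := h _ _ _ _ _ _ cA nA st gA.
exists B, y, psi; split; first by rewrite nB gB.
by split; [exact: le_lt_trans ce| |]; apply: le_lt_trans ce; apply: opnorm_le.
Qed.
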